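(* There exists a bounded degree unimodular random rooted graph $(G,\rho)$ such that, almost surely, $p_c(G)<1$ and, conditionally on $(G,\rho)$, Bernoulli bond percolation $G[p_c(G)]$ contains an infinite cluster almost surely.
   Context: A random rooted graph $(G,\rho)$ is a random variable taking values in the space of isomorphism classes of connected, locally finite rooted graphs. It is unimodular if it satisfies the mass-transport principle: $\mathbb{E}\big[\sum_{v\in V(G)} f(G,\rho,v)\big]=\mathbb{E}\big[\sum_{v\in V(G)} f(G,v,\rho)\big]$ for every measurable function $f$ from the space of isomorphism classes of doubly rooted connected, locally finite graphs to $[0,\infty]$. It is bounded degree if there is a deterministic constant $D$ such that all vertices of $G$ have degree at most $D$ almost surely. For $p\in[0,1]$, Bernoulli bond percolation $G[p]$ on a connected, locally finite graph $G$ is the random subgraph obtained by deleting each edge of $G$ independently with probability $1-p$ (retained edges are called open). A cluster is a connected component of $G[p]$. For infinite $G$, the critical parameter is $p_c(G)=\inf\{p\in[0,1]: G[p]\text{ contains an infinite connected component almost surely}\}$. For a random graph $G$, $p_c(G)$ and the percolation are defined conditionally on $G$. *)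

(* Defs.v *)
From HB Require Import structures.
From mathcomp Require Import all_boot all_order all_algebra.
From mathcomp Require Import all_classical all_reals all_analysis.
From mathcomp Require Import measurable_realfun lra.
Set Implicit Arguments.
Unset Strict Implicit.
Unset Printing Implicit Defensive.
Import Order.TTheory GRing.Theory Num.Theory.
Import numFieldNormedType.Exports.
Local Open Scope classical_set_scope.
Local Open Scope quotient_scope.
Local Open Scope ring_scope.

(* Simple graphs. A connected locally finite graph is countable, so every
   isomorphism class has a representative whose vertex set is a set of natural
   numbers. *)
Record graph := Graph {
  vert : set nat;
  adj : rel vert;
  adj_sym : symmetric adj;
  adj_irr : irreflexive adj }.
Arguments adj : clear implicits.

Section Graphs.
Variable G : graph.

Definition linked (u v : vert G) : Prop :=
  exists p : seq (vert G), path (adj G) u p /\ last u p = v.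

Definition connected_graph := forall u v : vert G, linked u v.

Definition neighbors (v : vert G) : set (vert G) := [set u | adj G v u].

Definition locally_finite := forall v, finite_set (neighbors v).

Definition degree_le (D : nat) := forall v, (neighbors v #<= `I_D)%card.

Definition cluster (v : vert G) : set (vert G) := [set u | linked v u].

Definition has_infinite_cluster := exists v, infinite_set (cluster v).

End Graphs.

(* Connected locally finite graphs with k+1 marked vertices: k = 0 gives the
   rooted graphs and k = 1 the doubly rooted ones. *)
Record marked_graph (k : nat) := MarkedGraph {
  mgraph :> graph;
  mgraph_connected : connected_graph mgraph;
  mgraph_locally_finite : locally_finite mgraph;
  marks : k.+1.-tuple (vert mgraph) }.

HB.instance Definition _ k := gen_eqMixin (marked_graph k).
HB.instance Definition _ k := gen_choiceMixin (marked_graph k).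

Section marked_graphs.
Variable k : nat.
Implicit Types G H K : marked_graph k.

(* isomorphism, preserving the marks, between the subgraphs of G and H induced
   by A and B *)
Definition induced_iso G H (A : set (vert G)) (B : set (vert H)) : Prop :=
  exists phi : vert G -> vert H,
    [/\ set_bij A B phi,
        forall u v, A u -> A v -> adj H (phi u) (phi v) = adj G u v &
        forall i, phi (tnth (marks G) i) = tnth (marks H) i].

Definition marked_iso G H : Prop := @induced_iso G H setT setT.

Definition mball G (r : nat) : set (vert G) :=
  [set v | exists i p, [/\ path (adj G) (tnth (marks G) i) p,
                           last (tnth (marks G) i) p = v & (size p <= r)%N]].

Definition local_iso (r : nat) G H : Prop := induced_iso (@mball G r) (@mball H r).

Lemma marked_iso_refl G : marked_iso G G.
Proof. by exists id; split=> //; by rewrite setTT_bijective; exists id. Qed.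

Lemma marked_iso_sym G H : marked_iso G H -> marked_iso H G.
Proof.
move=> [phi []]; rewrite setTT_bijective => -[psi phiK psiK] phiA phiM.
exists psi; split=> [|u v _ _|i].
- by rewrite setTT_bijective; exists phi.
- by rewrite -phiA// !psiK.
- by rewrite -phiM phiK.
Qed.

Lemma marked_iso_trans G H K :
  marked_iso G H -> marked_iso H K -> marked_iso G K.
Proof.
move=> [f [fb fA fM]] [g [gb gA gM]]; exists (g \o f); split=> [|u v _ _|i] /=.
- exact: set_bij_comp fb gb.
- by rewrite gA// fA.
- by rewrite fM gM.
Qed.

Definition marked_isob G H : bool := `[< marked_iso G H >].

Lemma marked_isob_equiv : equiv_class_of marked_isob.
Proof.
split=> [G|G H|H G K].
- exact/asboolP/marked_iso_refl.
- by apply/asboolP/asboolP; exact: marked_iso_sym.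
- by move=> /asboolP GH /asboolP HK; apply/asboolP; exact: marked_iso_trans HK.
Qed.

Canonical marked_iso_equiv := EquivRelPack marked_isob_equiv.

Definition marked_class := {eq_quot marked_iso_equiv}.

HB.instance Definition _ := Choice.on marked_class.
HB.instance Definition _ := EqQuotient.on marked_class.

Definition K1 : graph :=
  @Graph [set 0%N] (fun _ _ => false) (fun _ _ => erefl) (fun _ => erefl).

Lemma K1_connected : connected_graph K1.
Proof.
by move=> u v; exists [::]; split=> //=; apply: val_inj; rewrite (set_valP u) (set_valP v).
Qed.

Lemma K1_locally_finite : locally_finite K1.
Proof. by move=> v; rewrite (_ : neighbors v = set0)// predeqE. Qed.

Definition K1_marked : marked_graph k :=
  MarkedGraph K1_connected K1_locally_finite
    (nseq_tuple k.+1 (SigSub (mem_set (erefl : [set 0%N] 0%N)) : vert K1)).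

HB.instance Definition _ := isPointed.Build marked_class (\pi_marked_class K1_marked).

(* the open sets of the local topology: x and y are close when they have
   isomorphic balls of large radius around their marks *)
Definition local_open : set (set marked_class) :=
  [set U | forall x, U x -> exists r, forall y,
    local_iso r (repr x) (repr y) -> U y].

Definition marked_space := g_sigma_algebraType local_open.

HB.instance Definition _ := Measurable.on marked_space.

End marked_graphs.

(* States (open = true) of all potential edges of a graph on the natural
   numbers, the edge {i, j} with i < j being indexed by (i, j). *)
Definition edge_state := (nat * nat -> bool)%type.

Definition edge_index (i j : nat) : nat * nat := (minn i j, maxn i j).

Definition open_cylinders : set (set edge_state) :=
  [set C | exists e, C = [set w : edge_state | w e]].

HB.instance Definition _ := Pointed.on edge_state.

Definition config := g_sigma_algebraType open_cylinders.

HB.instance Definition _ := Measurable.on config.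

(* The events `e is open' are mutually independent and of probability p: the
   product rule over finite families of events. This determines mu. *)
Definition bernoulli_law (R : realType) (p : R) (mu : probability config R) :=
  forall F : seq (nat * nat), uniq F ->
    mu [set w : config | all w F] = (p ^+ size F)%:E.

(* The product measure is the law of the digits of a uniform point of [0, 1]
   in the expansion which splits every interval in proportions p and 1 - p. *)
Section BernoulliExistence.
Variables (R : realType) (p : R).
Hypothesis p01 : 0 <= p <= 1.

Let shift (u : R) : R := if u < p then u / p else (u - p) / (1 - p).

Let match_head (o : option bool) (u : R) :=
  if o is Some b then (u < p) == b else true.

Let Fixpoint match_digits (m : seq (option bool)) (u : R) : bool :=
  if m is o :: m' then match_head o u && match_digits m' (shift u) else true.

Let w1 (o : option bool) : R :=
  if o is Some b then (if b then p else 1 - p) else 1.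

Let weight (m : seq (option bool)) : R := \prod_(o <- m) w1 o.

Let I01 : set R := `[0, 1[.

Let cyl m := I01 `&` [set u | match_digits m u].

Let cyl_full (s : seq bool) : exists a, [/\ 0 <= a,
  0 <= weight (map Some s), a + weight (map Some s) <= 1 &
  cyl (map Some s) = [set` `[a, a + weight (map Some s)[] ].
Proof.
have /andP[p0 p1] := p01.
elim: s => [|b s [a [a0 w0 aw1 IH]]].
  exists 0; rewrite /weight /= big_nil; split; rewrite ?add0r ?lexx//.
  by rewrite /cyl /= /I01 (_ : [set u : R | true] = setT) ?setIT// predeqE.
set w := weight (map Some s) in w0 aw1 IH.
have wE : weight (map Some (b :: s)) = (if b then p else 1 - p) * w.
  by rewrite /weight /= big_cons.
have IH' u : 0 <= u < 1 -> match_digits (map Some s) u = (a <= u < a + w).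
  move=> u01; apply/idP/idP => h.
    have : cyl (map Some s) u by split; rewrite //= /I01 /= in_itv.
    by rewrite IH /= in_itv.
  have : [set` `[a, a + w[] u by rewrite /= in_itv.
  by rewrite -IH => -[].
rewrite wE; case: b {wE}.
  exists (p * a); split; [nra|nra|nra|].
  apply/seteqP; split => u; rewrite /cyl /I01 /= !in_itv/=.
    move=> [/andP[u0 u1]]; rewrite eqb_id /shift => /andP[up]; rewrite up.
    have p_gt0 : 0 < p by lra.
    rewrite IH'; last by rewrite divr_ge0//= ?ltr_pdivrMr//; lra.
    by rewrite ler_pdivlMr// ltr_pdivrMr// mulrDl (mulrC a) (mulrC w).
  move=> /andP[u1 u2].
  have p_gt0 : 0 < p by rewrite lt_neqAle p0 andbT; apply/eqP => pE; subst p; lra.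
  have up : u < p by nra.
  have u0 : 0 <= u by nra.
  split; first by apply/andP; split; lra.
  rewrite up eqxx /= /shift up IH'; last by rewrite divr_ge0//= ?ltr_pdivrMr//; lra.
  by rewrite ler_pdivlMr// ltr_pdivrMr// mulrDl (mulrC a) (mulrC w); apply/andP; split.
exists (p + (1 - p) * a); split; [nra|nra|nra|].
apply/seteqP; split => u; rewrite /cyl /I01 /= !in_itv/=.
  move=> [/andP[u0 u1]] /andP[]; rewrite eqbF_neg -leNgt => up.
  rewrite /shift ltNge up /=.
  have p_lt1 : 0 < 1 - p by lra.
  rewrite IH'; last by rewrite divr_ge0//= ?ltr_pdivrMr//; lra.
  by rewrite ler_pdivlMr// ltr_pdivrMr// => /andP[h1 h2]; apply/andP; split; lra.
move=> /andP[u1 u2].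
have p_lt1 : 0 < 1 - p.
  by rewrite lt_neqAle subr_ge0 p1 andbT; apply/eqP => pE; rewrite -pE in u1 u2; lra.
have up : p <= u by nra.
have u01 : u < 1 by nra.
split; first by apply/andP; split; lra.
rewrite eqbF_neg -leNgt up /= /shift ltNge up /=.
rewrite IH'; last by rewrite divr_ge0//= ?ltr_pdivrMr//; lra.
by rewrite ler_pdivlMr// ltr_pdivrMr//; apply/andP; split; lra.
Qed.

Let match_split (a m : seq (option bool)) u : match_digits (a ++ None :: m) u =
  match_digits (a ++ Some true :: m) u || match_digits (a ++ Some false :: m) u.
Proof.
elim: a u => [|o a IH] u /=; last by rewrite IH andb_orr.
by case: (u < p) => //=; rewrite ?orbF.
Qed.

Let match_disj (a m : seq (option bool)) u :
  match_digits (a ++ Some true :: m) u -> match_digits (a ++ Some false :: m) u ->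
  False.
Proof.
elim: a u => [|o a IH] u /=; first by case: (u < p).
by move=> /andP[_ h] /andP[_ h']; exact: IH h h'.
Qed.

Let cyl_measure (s : seq bool) m : measurable (cyl (map Some s ++ m)) /\
  lebesgue_measure (cyl (map Some s ++ m)) = (weight (map Some s ++ m))%:E.
Proof.
elim: m s => [|o m IH] s.
  rewrite cats0; have [a [a0 w0 aw1 ->]] := cyl_full s; split; first exact: measurable_itv.
  rewrite lebesgue_measure_itv /= lte_fin ltrDl; case: ltP => w0'.
    by rewrite -EFinB addrC addKr.
  by congr (_%:E); lra.
have rc b : map Some s ++ Some b :: m = map Some (rcons s b) ++ m.
  by rewrite map_rcons cat_rcons.
case: o => [b|]; first by rewrite rc; exact: IH.
have [mt et] := IH (rcons s true); have [mf ef] := IH (rcons s false).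
have -> : cyl (map Some s ++ None :: m) =
    cyl (map Some (rcons s true) ++ m) `|` cyl (map Some (rcons s false) ++ m).
  rewrite -!rc /cyl -setIUr; congr (_ `&` _).
  by apply/seteqP; split => u /=; rewrite match_split => /orP.
split; first exact: measurableU.
rewrite measureU//; last first.
  apply/seteqP; split => // u; rewrite -!rc => -[[_ /= h] [_ /= h']].
  exact: match_disj h h'.
rewrite -[RHS]/(weight (map Some s ++ None :: m))%:E.
transitivity ((weight (map Some (rcons s true) ++ m))%:E +
   (weight (map Some (rcons s false) ++ m))%:E)%E; first by congr (_ + _)%E.
rewrite -EFinD; congr (_%:E); rewrite -!rc /weight !big_cat !big_cons /=.
by nra.
Qed.

Let digit_at (K : seq nat) i : option bool := if i \in K then Some true else None.

Let match_mkseq (K : seq nat) n m u :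
  match_digits [seq digit_at K i | i <- iota m n] u =
  all (fun i => (i \in K) ==> (iter (i - m) shift u < p)) (iota m n).
Proof.
elim: n m u => [//|n IH] m u /=.
rewrite IH subnn /digit_at; congr andb; first by case: (m \in K) => //=; rewrite eqb_id.
apply: eq_in_all => i; rewrite mem_iota => /andP[mi _].
by rewrite -(subnSK mi) iterSr.
Qed.

Let digits (u : measurableTypeR R) : config := fun e => iter (pickle e) shift u < p.

Let measurable_shift : measurable_fun setT shift.
Proof.
apply: measurable_fun_ifT; first exact: measurable_fun_ltr.
  by apply: measurable_funM.
by apply: measurable_funM => //; exact: measurable_funB.
Qed.

Let measurable_iter_shift i : measurable_fun setT (iter i shift).
Proof.
elim: i => [|i IH]; first exact: measurable_id.
exact: (measurableT_comp measurable_shift IH). Qed.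

Let measurable_digits : measurable_fun setT digits.
Proof.
apply: (@measurability _ _ _ config setT digits open_cylinders) => //.
move=> _ [_ [e ->] <-]; rewrite setTI.
rewrite [X in measurable X](_ : _ =
  (fun u => iter (pickle e) shift u < p) @^-1` [set true]); last first.
  by apply/seteqP; split.
rewrite -[X in measurable X]setTI.
exact: (measurable_fun_ltr (measurable_iter_shift _) (measurable_cst _)).
Qed.

Let mI01 : measurable I01. Proof. exact: measurable_itv. Qed.

Let unif : set (measurableTypeR R) -> \bar R := mrestr lebesgue_measure mI01.

HB.instance Definition _ := Measure.on unif.

Let unif_setT : unif setT = 1%:E.
Proof.
rewrite /unif /mrestr setTI /I01 lebesgue_measure_itv /= lte_fin ltr01.
by rewrite sube0.
Qed.

HB.instance Definition _ := @Measure_isProbability.Build _ _ _ unif unif_setT.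

HB.instance Definition _ := @isMeasurableFun.Build _ _ _ _ digits measurable_digits.

Lemma bernoulli_law_exists01 : exists mu : probability config R, bernoulli_law p mu.
Proof.
exists (distribution unif digits) => F Funiq.
pose K := map pickle F.
have [n Kn] : exists n, forall i, i \in K -> (i < n)%N.
  by exists (\max_(i <- K) i).+1 => i iK; rewrite ltnS; exact: leq_bigmax_seq.
pose m := [seq digit_at K i | i <- iota 0 n].
have preE : digits @^-1` [set w | all w F] `&` I01 = cyl m.
  rewrite setIC; congr (_ `&` _); apply/seteqP; split=> u /=.
    move=> /allP h; rewrite /m match_mkseq; apply/allP => i _; apply/implyP.
    by move=> /mapP[e eF ->]; rewrite subn0; exact: h.
  rewrite /m match_mkseq => /allP h; apply/allP => e eF.
  have eK : pickle e \in K by exact: map_f.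
  have := h (pickle e); rewrite mem_iota /= add0n Kn// eK subn0 /=; exact.
have [_ cE] := cyl_measure [::] m.
rewrite /distribution /pushforward /= /unif /mrestr.
rewrite preE [LHS]cE; congr (_%:E).
rewrite /weight /m /= big_map.
have -> : size F = count (mem K) (iota 0 n).
  rewrite -(size_map pickle F) -/K -size_filter; apply: perm_size.
  apply: uniq_perm; rewrite ?filter_uniq ?iota_uniq//.
    by rewrite map_inj_uniq//; exact: pcan_inj pickleK.
  by move=> i; rewrite mem_filter mem_iota /= add0n; case: (boolP (i \in K)) => //= /Kn ->.
elim: (iota 0 n) => [|i s IH]; first by rewrite big_nil.
by rewrite big_cons IH /= /digit_at; case: (i \in K); rewrite ?exprS ?mul1r.
Qed.

End BernoulliExistence.

Section Percolation.
Variable R : realType.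
Implicit Types p : R.

Lemma bernoulli_law_exists p :
  exists mu : probability config R, 0 <= p <= 1 -> bernoulli_law p mu.
Proof.
have [p01|_] := boolP (0 <= p <= 1).
  by have [mu muP] := bernoulli_law_exists01 p01; exists mu.
have [|mu _] := @bernoulli_law_exists01 R 0; first by rewrite lexx ler01.
by exists mu.
Qed.

(* only meaningful for p in [0, 1] *)
Definition bernoulli_measure p : probability config R :=
  sval (cid (bernoulli_law_exists p)).

Lemma bernoulli_measureP p : 0 <= p <= 1 -> bernoulli_law p (bernoulli_measure p).
Proof. exact: svalP (cid (bernoulli_law_exists p)). Qed.

Section OpenSubgraph.
Variables (G : graph) (w : config).

Definition open_adj (u v : vert G) : bool :=
  adj G u v && w (edge_index (val u) (val v)).

Lemma open_adj_sym : symmetric open_adj.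
Proof. by move=> u v; rewrite /open_adj adj_sym /edge_index minnC maxnC. Qed.

Lemma open_adj_irr : irreflexive open_adj.
Proof. by move=> u; rewrite /open_adj adj_irr. Qed.

Definition open_subgraph : graph := Graph open_adj_sym open_adj_irr.

End OpenSubgraph.

Definition percolates (G : graph) p : Prop :=
  {ae bernoulli_measure p, forall w, has_infinite_cluster (open_subgraph G w)}.

(* Meaningful for infinite connected G, for which p = 1 belongs to the set; for
   finite G the set is empty, and inf set0 = 0 is a junk value. *)
Definition critical_probability (G : graph) : R :=
  inf [set p | 0 <= p <= 1 /\ percolates G p].

End Percolation.
Arguments critical_probability : clear implicits.

Notation rooted_space := (marked_space 0).
Notation birooted_space := (marked_space 1).

Definition representative k (x : marked_space k) : marked_graph k :=
  repr (x : marked_class k).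

Definition root (G : marked_graph 0) : vert G := thead (marks G).

Definition birooted_class (G : marked_graph 0) (u v : vert G) : birooted_space :=
  \pi_(marked_class 1)
    (MarkedGraph (@mgraph_connected _ G) (@mgraph_locally_finite _ G) [tuple u; v]).

Definition unimodular (R : realType) d (T : measurableType d)
    (P : probability T R) (X : {RV P >-> rooted_space}) : Prop :=
  forall f : birooted_space -> \bar R,
    measurable_fun setT f -> (forall x, 0 <= f x)%E ->
    (\int[P]_t (let G := representative (X t) in
       \esum_(v in [set: vert G]) f (birooted_class (root G) v)) =
     \int[P]_t (let G := representative (X t) in
       \esum_(v in [set: vert G]) f (birooted_class v (root G))))%E.

Definition bounded_degree (R : realType) d (T : measurableType d)
    (P : probability T R) (X : {RV P >-> rooted_space}) : Prop :=
  exists D : nat, {ae P, forall t, degree_le (representative (X t)) D}.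

(* Main.v *)
Require Import Defs.
From HB Require Import structures.
From mathcomp Require Import all_boot all_order all_algebra.
From mathcomp Require Import all_fingroup.
From mathcomp Require Import all_classical all_reals all_analysis.
From mathcomp Require Import measurable_realfun zify lra.
From Stdlib Require PeanoNat.
Set Implicit Arguments.
Unset Strict Implicit.
Unset Printing Implicit Defensive.
Import Order.TTheory GRing.Theory Num.Theory.
Import numFieldNormedType.Exports.

(** The example is a deterministic one-ended graph, the canopy, seen from a random
    root; all the randomness of the rooted graph is in the choice of the root.

    Vertices sit in blocks arranged as in a canopy tree of branching number 8: block a
    of level n has as parent the block a / 8 of level n + 1. A block of level n is an
    expander on width n vertices, its connector, from each vertex of which a path with
    n + 1 edges, a column, leads to the vertex with the same label in the connector of
    the parent. The columns are the only way up, every vertex has finitely many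
    descendants, and the eight children of a block are attached in the same way.

    Threshold. Let p0 = 31/32. The width is about n p0^-n, so that the expected number
    of fully open columns leaving a block of level n is about n (p / p0)^n. For p < p0
    it is summable: almost surely only finitely many blocks of the ancestral line are
    left through an open column, and an infinite cluster would have to leave all of them
    (not_percolates_lt_p0). At p = p0 it is of order n. A closed cut of a connector into
    two parts of linear size has linearly many edges, and p0 is so close to 1 that a
    union bound over all cuts makes such a cut unlikely; without it, more than three
    quarters of the connector lie in one open cluster (exists_giant_component). Linearly
    many columns then join the giant clusters of two consecutive connectors, and they
    are independent of them, so that one is open except with probability at most
    2^-(n+1). By the Borel-Cantelli lemma the giant clusters of the blocks 0 of all large
    levels belong to a single infinite cluster (percolates_p0). Hence the critical
    probability is p0, and there is percolation at p0.

    The vertices of a connector have bounded degree, hence are isolated with positive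
    probability; this is why single vertices cannot serve as the cut points of the
    one-ended structure and why expanders are used. The expanders are obtained by
    counting permutations (exists_expanding_perms).

    Unimodularity. The bitwise exclusive or makes the block indices a group of exponent
    2, which acts on the canopy by automorphisms: g sends block a of level n to block
    a xor (g / 8^n), and has 8^n elements fixing a given block. Choosing the root in a
    block 0 with probability proportional to 8^-n gives each orbit a mass inversely
    proportional to the order of its stabilizers; the mass-transport principle becomes
    a sum over orbits u, v and group elements g of f (u, g v), symmetric because
    f (u, g v) = f (g u, v) (mass_transport_sum). The total mass is finite because the
    width is at most 8 2^n.

    The representative of an isomorphism class is only known up to isomorphism, so
    percolation is studied on an arbitrary graph H, given with a bijection phi from the
    vertices of the canopy that preserves adjacency. *)

(** * Expanders and giant components *)

Section finite_graphs.
(* Sets are finite sets throughout this section. *)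
Import mathcomp.boot.finset.

(** Restriction to S maps these permutations to injections of S into W, and two
    permutations with the same restriction differ by a permutation of the complement. *)
Lemma card_perm_into (T : finType) (S W : {set T}) :
  (#|[set s : {perm T} | s @: S \subset W]| <=
     #|W| ^_ #|S| * (#|T| - #|S|)`!)%N.
Proof.
pose rs (s : {perm T}) : {ffun {x | x \in S} -> T} := [ffun x => s (val x)].
pose I := [set f : {ffun {x | x \in S} -> T} | injectiveb f & f \in ffun_on (mem W)].
have cardI : (#|I| <= #|W| ^_ #|S|)%N.
  rewrite -[#|S|]card_sig -card_inj_ffuns_on.
  by apply: subset_leq_card; apply/fintype.subsetP => f; rewrite !inE andbC.
have rsI s : s \in [set s : {perm T} | s @: S \subset W] -> rs s \in I.
  rewrite !inE => /fintype.subsetP sW; apply/andP; split.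
    by apply/injectiveP => x y; rewrite !ffunE => /perm_inj/val_inj.
  by apply/ffun_onP => x; rewrite ffunE; apply/sW/imset_f/(valP x).
rewrite -sum1_card (partition_big rs (mem I)) //=.
apply: leq_trans (leq_mul cardI (leqnn _)).
rewrite -sum_nat_const; apply: leq_sum => f _; rewrite sum1dep_card.
set F := [set s | _]; have [->|[s0 s0F]] := set_0Vmem F; first by rewrite cards0.
have -> : (#|T| - #|S|)%N = #|~: S| by rewrite [RHS]cardsCs setCK.
rewrite -card_perm -(card_imset _ (mulIg s0^-1%g)).
apply: subset_leq_card; apply/fintype.subsetP => _ /imsetP[s sF ->].
rewrite unfold_in; apply/fintype.subsetP => x; apply: contraR; rewrite inE negbK => xS.
rewrite permM; move: sF s0F; rewrite !inE => /andP[_ /eqP <-] /andP[_ /eqP].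
by move=> /ffunP/(_ (Sub x xS)); rewrite !ffunE /= => <-; rewrite permK.
Qed.

(** Each factor of the quotient of the falling factorials is at most 3/4. *)
Lemma ffact_le_ratio M k :
  (k <= 3 * M)%N -> ((3 * M) ^_ k * 4 ^ k <= (4 * M) ^_ k * 3 ^ k)%N.
Proof.
elim: k => [|k IH] kM; first by rewrite !ffactn0.
rewrite !ffactnSr !expnS mulnACA [leqRHS]mulnACA.
have -> : ((3 * M) ^_ k * 4 * ((3 * M - k) * 4 ^ k) =
  ((3 * M) ^_ k * 4 ^ k) * ((3 * M - k) * 4))%N by nia.
have -> : ((4 * M) ^_ k * 3 * ((4 * M - k) * 3 ^ k) =
  ((4 * M) ^_ k * 3 ^ k) * ((4 * M - k) * 3))%N by nia.
by apply: leq_mul; [apply: IH; lia|lia].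
Qed.

(** 3^20 = (3^5)^4 < (2^8)^4, which avoids evaluating unary powers. *)
Lemma lt_pow20 : (2 ^ 8 * 3 ^ 20 < 4 ^ 20)%N.
Proof.
have -> : 20 = (5 * 4)%N by [].
rewrite !(expnM _ 5); have -> : (4 ^ 5 = 2 ^ 2 * 2 ^ 8)%N by [].
rewrite (expnMn (2 ^ 2)) -(expnM 2 2 4) (@ltn_pmul2l (2 ^ 8)); last by [].

by rewrite (ltn_exp2r (3 ^ 5) (2 ^ 8) (e := 4)).
Qed.

(** A random permutation maps a given S of size M into a given W of size 3 M with
    probability at most (3/4)^M, and there are at most 4^(4 M) pairs (S, W). Twenty
    independent permutations suffice because 256 (3/4)^20 < 1. *)
Lemma exists_expanding_perms M : (0 < M)%N ->
  exists s : {ffun 'I_20 -> {perm 'I_(4 * M)}},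
    forall S W : {set 'I_(4 * M)}, #|S| = M -> #|W| = (3 * M)%N ->
      ~ (forall i, s i @: S \subset W).
Proof.
move=> M0; set N := (4 * M)%N.
pose into (S W : {set 'I_N}) := [set s : {perm 'I_N} | s @: S \subset W].
pose bad (SW : {set 'I_N} * {set 'I_N}) :=
  if (#|SW.1| == M) && (#|SW.2| == 3 * M)%N then
  [set s : {ffun 'I_20 -> {perm 'I_N}} | s \in ffun_on (mem (into SW.1 SW.2))] else set0.
have into_le (S W : {set 'I_N}) : #|S| = M -> #|W| = (3 * M)%N ->
    (#|into S W| * 4 ^ M <= N`! * 3 ^ M)%N.
  move=> cS cW; have := card_perm_into S W; rewrite cS cW card_ord => h.
  apply: leq_trans (leq_mul h (leqnn _)) _.
  rewrite -mulnA (mulnC _`!) mulnA.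
  have MN : (M <= N)%N by rewrite /N; lia.
  rewrite -(ffact_fact MN) (mulnAC _ (N - M)`!).
  by apply: leq_mul => //; apply: ffact_le_ratio; lia.
have bad_le SW : (#|bad SW| * 4 ^ (20 * M) <= N`! ^ 20 * 3 ^ (20 * M))%N.
  rewrite /bad; case: ifPn => [/andP[/eqP cS /eqP cW]|_]; last by rewrite cards0.
  rewrite cardsE card_ffun_on card_ord !(mulnC 20%N) !expnM -!expnMn leq_exp2r//.
  exact: into_le.
have cupE : (#|\bigcup_SW bad SW| <= \sum_SW #|bad SW|)%N.
  elim/big_ind2: _ => [|A m B n Am Bn|//]; first by rewrite cards0.
  by apply: leq_trans (leq_add Am Bn); rewrite cardsU leq_subr.
have lt_bad : (#|\bigcup_SW bad SW| < N`! ^ 20)%N.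
  rewrite -(ltn_pmul2r (m := 4 ^ (20 * M))) ?expn_gt0//.
  apply: leq_ltn_trans (leq_mul cupE (leqnn _)) _.
  rewrite big_distrl /=; apply: leq_ltn_trans (leq_sum _ (fun SW _ => bad_le SW)) _.
  have cset : #|{set 'I_N}| = (2 ^ N)%N.
    by rewrite -cardsT -powersetT card_powerset cardsT card_ord.
  rewrite sum_nat_const card_prod cset mulnCA ltn_pmul2l ?expn_gt0 ?fact_gt0//.
  rewrite -expnD (_ : (N + N)%N = (8 * M)%N); last by rewrite /N; lia.
  by rewrite (expnM 2) (expnM 3) (expnM 4) -expnMn (ltn_exp2r _ _ M0); exact: lt_pow20.
have [s sbad] : exists s, s \notin \bigcup_SW bad SW.
  apply/existsP; apply: contraLR lt_bad; rewrite negb_exists -leqNgt => /forallP sin.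
  have -> : (N`! ^ 20 = #|{ffun 'I_20 -> {perm 'I_N}}|)%N.
    by rewrite card_ffun (card_ord 20) card_Sn.
  by apply: subset_leq_card; apply/fintype.subsetP => s _; have := sin s; rewrite negbK.
exists s => S W cS cW sub; move/bigcupP: sbad; apply; exists (S, W) => //.
rewrite /bad /= cS cW !eqxx /= inE; apply/ffun_onP => i; rewrite inE; exact: sub.
Qed.

(** A graph on the numbers below 4 M of degree at most 42, two for each of the 20
    permutations and two for the path x ~ x + 1, which serves only to make it connected.
    The expansion property is restricted to sets of linear size and counts the
    endpoints of the edges leaving S, which are in particular ends of distinct edges. *)
Record expander_rel (M : nat) (e : rel nat) : Prop := ExpanderRel {
  expander_sym : symmetric e;
  expander_irr : irreflexive e;
  expander_lt : forall x y, e x y -> (x < 4 * M)%N;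
  expander_next : forall x, (x.+1 < 4 * M)%N -> e x x.+1;
  expander_degree : forall x,
    exists2 s : seq nat, (size s <= 42)%N & forall y, e x y -> y \in s;
  expander_boundary : forall S : {set 'I_(4 * M)}, (M <= #|S| <= 2 * M)%N ->
    (M <= #|[set y : 'I_(4 * M) | (y \notin S) && [exists x in S, e x y]]|)%N }.

Lemma exists_subset_card (T : finType) (A : {set T}) k :
  (k <= #|A|)%N -> exists2 B : {set T}, B \subset A & #|B| = k.
Proof.
move=> kA; exists [set x in take k (enum A)].
  by apply/fintype.subsetP => x; rewrite inE => /mem_take; rewrite mem_enum.
by rewrite cardsE (card_uniqP _) ?take_uniq ?enum_uniq// size_take_min -cardE (minn_idPl _).
Qed.

Lemma exists_superset_card (T : finType) (A : {set T}) k :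
  (#|A| <= k <= #|T|)%N -> exists2 B : {set T}, A \subset B & #|B| = k.
Proof.
move=> /andP[Ak kT].
have [|C CA Ck] := @exists_subset_card _ (~: A) (#|T| - k)%N.
  by rewrite [leqRHS](cardsCs (~: A)) setCK leq_sub2l.
exists (~: C); first by rewrite -setCS setCK.
by rewrite cardsCs setCK Ck subKn.
Qed.

(** If the set B of outer neighbours of S had fewer than M elements, then S and B would
    be contained in some W of size 3 M into which all the permutations send a subset of
    S of size M. *)
Lemma exists_expander M : (0 < M)%N -> exists e, expander_rel M e.
Proof.
move=> M0; have [s sP] := exists_expanding_perms M0; set N := (4 * M)%N in s sP *.
pose c (u v : 'I_N) := (u != v) &&
  [|| [exists i, (s i u == v) || (s i v == u)], u.+1 == v :> nat | v.+1 == u :> nat].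
pose e x y := if (insub x, insub y) is (Some u, Some v) then c u v else false.
have eE (u v : 'I_N) : e u v = c u v by rewrite /e !valK.
have c_sym : symmetric c.
  move=> u v; rewrite /c eq_sym; congr andb; rewrite [X in _ || X]orbC; congr orb.
  by apply: eq_existsb => i; rewrite orbC.
have e_lt x y : e x y -> (x < N)%N by rewrite /e; case: insubP.
have e_sym : symmetric e.
  by move=> x y; rewrite /e; case: insubP => [u _ _|_]; case: insubP => // v _ _; rewrite c_sym.
exists e; split => //.
- by move=> x; rewrite /e; case: insubP => // u _ _; rewrite /c eqxx.
- move=> x xN; have := eE (Ordinal (ltnW xN)) (Ordinal xN) => /= ->.
  by rewrite /c /= eqxx orbT andbT -val_eqE /= neq_ltn ltnSn.
- move=> x; case: (boolP (x < N)%N) => [xN|xN]; last first.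
    by exists [::] => // y /e_lt; rewrite (negbTE xN).
  pose u := Ordinal xN.
  exists ([seq val (s i u) | i : 'I_20] ++ [seq val ((s i)^-1 u)%g | i : 'I_20]
    ++ [:: x.+1; x.-1]).
    by rewrite !size_cat !size_map -!enumT !size_enum_ord.
  move=> y xy; have yN : (y < N)%N by move: xy; rewrite e_sym => /e_lt.
  move: xy; rewrite -[y]/(val (Ordinal yN)) -[x]/(val u) eE => /andP[_].
  set v := Ordinal yN; rewrite !mem_cat => /or3P[/existsP[i /orP[] /eqP iv]|/eqP iv|/eqP iv].
  + by rewrite -iv (map_f (fun i => val (s i u))) ?mem_enum.
  + have -> : v = ((s i)^-1 u)%g by rewrite -iv permK.
    by rewrite (map_f (fun i => val ((s i)^-1 u)%g)) ?mem_enum ?orbT.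
  + by rewrite (_ : val v = x.+1) ?inE ?eqxx ?orbT.
  + rewrite (_ : val v = x.-1) ?inE ?eqxx ?orbT//.
    by have /= := congr1 predn iv.
move=> S /andP[MS S2M]; rewrite leqNgt; apply/negP => lt_M.
set B := [set y : 'I_N | _] in lt_M.
have [S' S'S cS'] := exists_subset_card MS.
have [|W SW cW] := @exists_superset_card _ (S :|: B) (3 * M).
  rewrite [X in (_ <= _ <= X)%N](card_ord N) leq_mul2r orbT andbT.
  by apply: leq_trans (leq_card_setU _ _).1 _; rewrite (mulSnr 2 M) leq_add // ltnW.
apply: (sP S' W cS' cW) => i; apply: fintype.subset_trans SW.
apply/fintype.subsetP => _ /imsetP[x /(fintype.subsetP S'S) xS ->].
rewrite !inE; case: (boolP (_ \in S)) => //= sxS; apply/existsP; exists x.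
rewrite xS eE /c /= (_ : x != s i x) /=.
  by apply/orP; left; apply/existsP; exists i; rewrite eqxx.
by apply: contraNneq sxS => <-.
Qed.

(** A union of clusters has fewer than M or more than 3 M elements, by the hypothesis
    applied to it or to its complement. If no cluster is large, a largest union of
    clusters with fewer than M elements can be enlarged by a cluster, to fewer than 2 M,
    hence to fewer than M elements. *)
Lemma exists_giant_component (T : finType) (r : rel T) M : symmetric r -> (0 < M)%N ->
  #|T| = (4 * M)%N ->
  (forall S : {set T}, (M <= #|S| <= 2 * M)%N ->
     exists x y, [/\ x \in S, y \notin S & r x y]) ->
  exists x, (3 * M < #|[set y | connect r x y]|)%N.
Proof.
move=> r_sym M0 cT open_cut.
pose closed_set (S : {set T}) := [forall x in S, forall y, r x y ==> (y \in S)].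
have closedP (S : {set T}) : reflect (forall x y, x \in S -> r x y -> y \in S) (closed_set S).
  apply: (iffP forall_inP) => [h x y /h/forallP/(_ y)/implyP|h x xS]; first exact.
  by apply/forallP => y; apply/implyP; exact: h.
have dichotomy (S : {set T}) : closed_set S -> (#|S| < M)%N || (3 * M < #|S|)%N.
  move=> Scl; have /closedP Sc := Scl; rewrite -[_ || _]negbK negb_or -!leqNgt.
  apply/negP => /andP[MS S3].
  have [S2|S2] := leqP #|S| (2 * M).
    have [|x [y [xS yS /(Sc _ _ xS)]]] := open_cut S; first by rewrite MS.
    by rewrite (negbTE yS).
  have [|x [y []]] := open_cut (~: S).
    have := cardsC S; rewrite cT => h.
    by apply/andP; split; lia.
  by rewrite !inE negbK => xS yS; rewrite r_sym => /(Sc _ _ yS); rewrite (negbTE xS).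
pose C x := [set y | connect r x y].
have C_closed x : closed_set (C x).
  by apply/closedP => y z; rewrite !inE => xy /connect1; exact: connect_trans.
apply/existsP; apply/contraT; rewrite negb_exists => /forallP small.
have set0_ok : closed_set set0 && (#|(set0 : {set T})| < M)%N.
  by rewrite cards0 M0 andbT; apply/closedP => x y; rewrite inE.
have [S /andP[Scl SM] Smax] := @arg_maxnP _ set0
  (fun S => closed_set S && (#|S| < M)%N) (fun S : {set T} => #|S|) set0_ok.
have [x xS] : exists x, x \notin S.
  apply/existsP; apply/contraT; rewrite negb_exists => /forallP all_in.
  suff : (#|T| <= #|S|)%N by rewrite cT; lia.
  by apply: subset_leq_card; apply/fintype.subsetP => x _; have := all_in x; rewrite negbK.
have CxM : (#|C x| < M)%N.
  by have /orP[//|Cx] := dichotomy _ (C_closed x); have := small x; rewrite Cx.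
have Ucl : closed_set (S :|: C x).
  apply/closedP => y z; rewrite !in_setU => /orP[yS|yC] yz; apply/orP.
    by left; exact: (closedP _ Scl y).
  by right; exact: (closedP _ (C_closed x) y).
have cU : (#|S :|: C x| < 2 * M)%N by rewrite (leq_ltn_trans (leq_card_setU _ _).1)//; lia.
have UM : (#|S :|: C x| < M)%N by have /orP[//|] := dichotomy _ Ucl; lia.
have Sle : (#|S :|: C x| <= #|S|)%N by apply: Smax; rewrite Ucl.
move: Sle; rewrite leqNgt => /negP[].
apply: proper_card; rewrite properE subsetUl /=; apply/fintype.subsetPn.
by exists x; rewrite // !inE connect0 orbT.
Qed.

Lemma giant_components_meet (T : finType) (r : rel T) M x y : symmetric r ->
  #|T| = (4 * M)%N -> (3 * M < #|[set z | connect r x z]|)%N ->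
  (3 * M < #|[set z | connect r y z]|)%N -> connect r x y.
Proof.
move=> r_sym cT; set A := [set z | connect r x z]; set B := [set z | _] => AM BM.
have /card_gt0P[z] : (0 < #|A :&: B|)%N.
  rewrite lt0n; apply/eqP => AB0; have UM : (#|A :|: B| <= 4 * M)%N by rewrite -cT max_card.
  by move: UM; rewrite -[#|_|]addn0 -AB0 cardsUI; lia.
rewrite !inE => /andP[xz]; rewrite (sym_connect_sym r_sym) => yz.
exact: connect_trans xz yz.
Qed.

End finite_graphs.

Local Open Scope classical_set_scope.
Local Open Scope quotient_scope.
Local Open Scope ring_scope.

(** * The canopy *)

(** The integer part of (32/31)^(n+1) plus one is p0^-(n+1) up to a factor 2; the factor
    n + 1 makes the mean number of open columns grow at p0, and is negligible against
    (p / p0)^n below p0. *)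
Definition quarter (n : nat) : nat := (n.+1 * (32 ^ n.+1 %/ 31 ^ n.+1 + 1))%N.

Definition width (n : nat) : nat := (4 * quarter n)%N.

Lemma quarter_gt0 n : (0 < quarter n)%N.
Proof. by rewrite /quarter muln_gt0 addn1. Qed.

Lemma width_gt0 n : (0 < width n)%N.
Proof. by rewrite /width muln_gt0 quarter_gt0. Qed.

Lemma leq_quarterS n : (quarter n <= quarter n.+1)%N.
Proof.
rewrite /quarter leq_mul// leq_add2r leq_divRL ?expn_gt0//.
rewrite [(31 ^ n.+2)%N]expnS [(32 ^ n.+2)%N]expnS mulnCA.
by apply: leq_mul => //; exact: leq_divM.
Qed.

(** Consecutive connectors have comparable sizes, so that most columns of a block lead to
    the giant cluster of the parent. *)
Lemma quarterS_leq n : (quarter n.+1 <= 2 * quarter n)%N.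
Proof.
rewrite /quarter; set q := (32 ^ n.+1 %/ 31 ^ n.+1)%N; set q' := (_ %/ _)%N.
have q1 : (1 <= q)%N by rewrite /q leq_divRL ?expn_gt0// mul1n leq_exp2r.
have h : (31 * q' < 32 * (q + 1))%N.
  have a : (q' * 31 ^ n.+2 <= 32 ^ n.+2)%N by exact: leq_divM.
  have b : (32 ^ n.+1 < (q + 1) * 31 ^ n.+1)%N by rewrite addn1 ltn_ceil ?expn_gt0.
  rewrite -(ltn_pmul2r (m := 31 ^ n.+1)) ?expn_gt0//.
  apply: (@leq_ltn_trans (32 ^ n.+2)%N); first by rewrite (mulnC 31%N) -mulnA -expnS.
  by rewrite [(32 ^ n.+2)%N]expnS -mulnA ltn_pmul2l.
have [n3|n3] := leqP 3 n; last first.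
  have q'1 : (q' < 2)%N.
    by rewrite /q' ltn_divLR ?expn_gt0//; case: n n3 {q q' q1 h} => [|[|[|]]].
  by clearbody q q'; nia.
clearbody q q'; have {}h : (31 * (q' + 1) <= 47 * (q + 1))%N by lia.
have {}h : (31 * (n.+2 * (q' + 1)) <= 47 * (n.+2 * (q + 1)))%N by nia.
have : (47 * n.+2 <= 62 * n.+1)%N by lia.
nia.
Qed.

Lemma leq_widthS n : (width n <= width n.+1)%N.
Proof. by rewrite leq_mul2l leq_quarterS. Qed.

(** The root weight 8^-n beats this bound times the n + 1 vertices of a column. *)
Lemma leq_width_exp n : (width n <= 8 * 2 ^ n)%N.
Proof.
elim: n => [|n IH]; first by rewrite /width /quarter !expn1.
by have := quarterS_leq n; rewrite expnS; move: IH; rewrite /width; lia.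
Qed.

Lemma shiftrS a k : Nat.shiftr a k.+1 = (Nat.shiftr a k)./2.
Proof.
rewrite -[LHS]/(Nat.div2 (Nat.shiftr a k)); move: (Nat.shiftr a k) => b.
have [c] := ubnP b; elim: c b => // c IH [|[|b]] //= bc.
by congr S; apply: IH; lia.
Qed.

Lemma shiftr_divn a k : Nat.shiftr a k = (a %/ 2 ^ k)%N.
Proof.
elim: k => [|k IH]; first by rewrite divn1.
by rewrite shiftrS IH expnSr divnMA divn2.
Qed.

Definition conn (n : nat) : rel nat := sval (cid (exists_expander (quarter_gt0 n))).

Lemma connP n : expander_rel (quarter n) (conn n).
Proof. exact: svalP (cid (exists_expander (quarter_gt0 n))). Qed.

(** A cell (n, x, j) is the vertex at height j of column x in a block of level n; the
    vertices of height 0 form the connector. *)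
Definition valid_cell (q : nat * nat * nat) : bool :=
  (q.1.2 < width q.1.1)%N && (q.2 <= q.1.1)%N.

Definition cell := {q : nat * nat * nat | valid_cell q}.

Definition vertex := (cell * nat)%type.

Implicit Types u v : vertex.

Definition level u : nat := (val u.1).1.1.
Definition column u : nat := (val u.1).1.2.
Definition height u : nat := (val u.1).2.
Definition block u : nat := u.2.

Lemma column_lt u : (column u < width (level u))%N.
Proof. by have /andP[] := valP u.1. Qed.

Lemma height_le u : (height u <= level u)%N.
Proof. by have /andP[] := valP u.1. Qed.

Definition mk_vertex n x j a (h : valid_cell (n, x, j)) : vertex := (Sub (n, x, j) h, a).

Lemma vertex_eq u v : level u = level v -> column u = column v ->
  height u = height v -> block u = block v -> u = v.
Proof.
case: u v => [[[[n x] j] h] a] [[[[n' x'] j'] h'] a']; rewrite /level /column /height /block /=.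
by move=> nn xx jj aa; subst; congr (_, _); exact: val_inj.
Qed.

Lemma valid_next u : valid_cell
  (if (height u < level u)%N then (level u, column u, (height u).+1)
   else ((level u).+1, column u, 0%N)).
Proof.
rewrite /valid_cell; case: ifPn => /= h; first by rewrite column_lt.
by rewrite (leq_trans (column_lt u)) ?leq_widthS.
Qed.

(** The vertex following u upwards along its column; after the top vertex of the column,
    the vertex of the parent connector with the same label. *)
Definition next_vertex u : vertex :=
  mk_vertex (if (height u < level u)%N then block u else Nat.shiftr (block u) 3)
    (valid_next u).

Definition edge_conn u v : bool :=
  [&& level u == level v, block u == block v, height u == 0%N, height v == 0%N
    & conn (level u) (column u) (column v)].

Definition edge u v : bool :=
  [|| edge_conn u v, v == next_vertex u | u == next_vertex v].

Lemma next_vertexP u :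
  ((height u < level u)%N /\ [/\ level (next_vertex u) = level u,
     column (next_vertex u) = column u, height (next_vertex u) = (height u).+1
     & block (next_vertex u) = block u]) \/
  (height u = level u /\ [/\ level (next_vertex u) = (level u).+1,
     column (next_vertex u) = column u, height (next_vertex u) = 0%N
     & block (next_vertex u) = Nat.shiftr (block u) 3]).
Proof.
rewrite /next_vertex /level /column /height /block /=.
case: ifPn => h /=; [by left|right; split=> //].
by apply/eqP; rewrite eqn_leq [X in X && _]height_le /= leqNgt.
Qed.

Lemma edge_conn_sym : symmetric edge_conn.
Proof.
move=> u v; rewrite /edge_conn [level v == _]eq_sym [block v == _]eq_sym.
case: (level u =P level v) => //= <-.
by rewrite (expander_sym (connP _)); congr andb; rewrite andbCA.
Qed.

Lemma edge_sym : symmetric edge.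
Proof. by move=> u v; rewrite /edge edge_conn_sym [X in _ || X]orbC. Qed.

Lemma next_vertex_neq u : u != next_vertex u.
Proof.
apply/eqP => uE; have := next_vertexP u; rewrite -uE.
by case=> [[_ []]|[_ []]] *; lia.
Qed.

Lemma edge_irr : irreflexive edge.
Proof.
move=> u; rewrite /edge /edge_conn (expander_irr (connP _)) !andbF /=.
by rewrite orbb (negbTE (next_vertex_neq u)).
Qed.

(** At most 42 neighbours in the connector, one upwards, one downwards inside the block,
    and eight downwards in the eight child blocks. *)
Lemma edge_degree u : exists2 s : seq (nat * nat * nat * nat), (size s <= 52)%N &
  forall v, edge u v -> (level v, column v, height v, block v) \in s.
Proof.
have [s sz sP] := expander_degree (connP (level u)) (column u).
pose raw v := (level v, column v, height v, block v).
exists ([seq (level u, y, 0%N, block u) | y <- s] ++ raw (next_vertex u) ::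
  (level u, column u, (height u).-1, block u) ::
  [seq ((level u).-1, column u, (level u).-1, (8 * block u + r)%N) | r <- iota 0 8]).
  by rewrite size_cat /= !size_map; lia.
move=> v /or3P[/and5P[/eqP luv /eqP buv _ /eqP hv cv]|/eqP ->|/eqP uE]; rewrite mem_cat.
- by rewrite -luv -buv hv map_f ?sP.
- by rewrite inE eqxx orbT.
- rewrite -/(raw v) 2!in_cons; have [[_ [lv cv hv bv]]|[lv [lv' cv hv bv]]] := next_vertexP v.
    by rewrite uE lv cv hv bv /= eqxx !orbT.
  apply/orP; right; apply/or3P/Or33/mapP.
  exists (block v %% 8)%N; first by rewrite mem_iota ltn_pmod.
  by rewrite /raw uE lv' cv bv lv shiftr_divn mulnC -divn_eq.
Qed.

(** An element g of the group of natural numbers under exclusive or acts on the blocks of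
    level n through its part above the 3 n lowest bits, which is compatible with taking
    parents because shifts commute with exclusive or. *)
Definition translate (g : nat) u : vertex :=
  (u.1, Nat.lxor (block u) (Nat.shiftr g (3 * level u))).

Lemma block_translate g u :
  block (translate g u) = Nat.lxor (block u) (Nat.shiftr g (3 * level u)).
Proof. by []. Qed.

Lemma translateK g : involutive (translate g).
Proof.
case=> b a; rewrite /translate /level /block /=; congr (_, _).
by rewrite PeanoNat.Nat.lxor_assoc PeanoNat.Nat.lxor_nilpotent PeanoNat.Nat.lxor_0_r.
Qed.

Lemma translate_next g u : next_vertex (translate g u) = translate g (next_vertex u).
Proof.
have [] := next_vertexP u; have [] := next_vertexP (translate g u);
  rewrite -![level (translate g u)]/(level u) -![height (translate g u)]/(height u);
  move=> [h [l1 c1 h1 b1]] [h' [l2 c2 h2 b2]]; try lia.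
  apply: vertex_eq; rewrite ?l1 ?c1 ?h1 ?b1.
  - exact/esym.
  - exact/esym.
  - exact/esym.
  - by rewrite !block_translate b2 l2.
apply: vertex_eq; rewrite ?l1 ?c1 ?h1 ?b1.
- exact/esym.
- exact/esym.
- exact/esym.
- rewrite !block_translate b2 l2.
  rewrite PeanoNat.Nat.shiftr_lxor PeanoNat.Nat.shiftr_shiftr mulnS addnC.
  by congr (Nat.lxor _ (Nat.shiftr _ _)); lia.
Qed.

Lemma translate_edge g u v : edge (translate g u) (translate g v) = edge u v.
Proof.
have trI := inv_inj (translateK g).
rewrite /edge !translate_next !(inj_eq trI); congr orb.
rewrite /edge_conn -![level (translate g _)]/(level _).
rewrite -![height (translate g _)]/(height _) -![column (translate g _)]/(column _).
case: (level u =P level v) => // luv; congr andb; congr andb.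
rewrite !block_translate luv; apply/eqP/eqP => [|->//].
move=> /(congr1 (Nat.lxor^~ (Nat.shiftr g (3 * level v)))).
by rewrite /= !PeanoNat.Nat.lxor_assoc PeanoNat.Nat.lxor_nilpotent !PeanoNat.Nat.lxor_0_r.
Qed.

(** * Connectedness *)
Section linking.
Variable r : rel vertex.
Hypothesis r_sym : symmetric r.

Definition joined u v : Prop := exists p, path r u p /\ last u p = v.

Lemma joined_refl u : joined u u. Proof. by exists [::]. Qed.

Lemma joined_trans u v w : joined u v -> joined v w -> joined u w.
Proof.
move=> [p [up pv]] [q [vq qw]]; exists (p ++ q).
by rewrite cat_path last_cat pv up.
Qed.

Lemma joined1 u v : r u v -> joined u v.
Proof. by move=> uv; exists [:: v]; rewrite /= uv. Qed.

Lemma joined_sym u v : joined u v -> joined v u.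
Proof.
move=> [p [up <-]]; elim: p u up => [|w p IH] u /=; first by move=> _; exact: joined_refl.
by move=> /andP[uw /IH wp]; apply: joined_trans wp (joined1 _); rewrite r_sym.
Qed.

End linking.

Lemma valid_bottom n x : (x < width n)%N -> valid_cell (n, x, 0%N).
Proof. by move=> xn; rewrite /valid_cell /= xn. Qed.

Lemma valid_corner n : valid_cell (n, 0%N, 0%N).
Proof. exact/valid_bottom/width_gt0. Qed.

Definition corner n a : vertex := mk_vertex a (valid_corner n).

Lemma edge_next u : edge u (next_vertex u).
Proof. by rewrite /edge eqxx orbT. Qed.

Lemma joined_column n x j a (h : valid_cell (n, x, 0%N)) (hj : valid_cell (n, x, j)) :
  joined edge (mk_vertex a h) (mk_vertex a hj).
Proof.
elim: j hj => [|j IH] hj.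
  by rewrite (_ : mk_vertex a hj = mk_vertex a h); [exact: joined_refl|exact: vertex_eq].
have hj' : valid_cell (n, x, j) by move: hj; rewrite /valid_cell /= => /andP[-> /ltnW ->].
apply: joined_trans (IH hj') _.
have -> : mk_vertex a hj = next_vertex (mk_vertex a hj').
  have jn : (j < n)%N by case/andP: hj.
  have [[_ [? ? ? ?]]|[e _]] := next_vertexP (mk_vertex a hj').
    exact/esym/vertex_eq.
  have ejn : j = n := e; by exfalso; move: (ltn_eqF jn); rewrite ejn eqxx.
exact/joined1/edge_next.
Qed.

Lemma joined_parent n a : joined edge (corner n a) (corner n.+1 (Nat.shiftr a 3)).
Proof.
have hn : valid_cell (n, 0%N, n) by rewrite /valid_cell /= width_gt0 /=.
apply: joined_trans (joined_column _ _ hn) _.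
have -> : corner n.+1 (Nat.shiftr a 3) = next_vertex (mk_vertex a hn).
  have [[e _]|[_ [? ? ? ?]]] := next_vertexP (mk_vertex a hn).
    by rewrite /height /level /= ltnn in e.
  exact/esym/vertex_eq.
exact/joined1/edge_next.
Qed.

Lemma joined_ancestor n a k : joined edge (corner n a) (corner (n + k) (Nat.shiftr a (3 * k))).
Proof.
elim: k => [|k IH]; first by rewrite addn0 muln0; exact: joined_refl.
apply: joined_trans IH _; have := joined_parent (n + k) (Nat.shiftr a (3 * k)).
by rewrite PeanoNat.Nat.shiftr_shiftr mulnS [(3 + _)%N]addnC addnS.
Qed.

Lemma joined_corner u : joined edge u (corner (level u) (block u)).
Proof.
have jS := joined_sym edge_sym.
have h0 := valid_bottom (column_lt u).
have hu : valid_cell (level u, column u, height u) by rewrite /valid_cell /= column_lt height_le.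
rewrite [X in joined _ X](_ : u = mk_vertex (block u) hu); last exact: vertex_eq.
apply: joined_trans (jS _ _ (joined_column _ h0 hu)) _; apply: jS.
move: (level u) (column u) (block u) h0 {hu} => n x a; elim: x => [|x IH] h.
  by rewrite (_ : mk_vertex a h = corner n a); [exact: joined_refl|exact: vertex_eq].
have hx : valid_cell (n, x, 0%N).
  by move: h; rewrite /valid_cell /= => /andP[/ltnW ->].
apply: joined_trans (IH hx) (joined1 _).
rewrite /edge /edge_conn /level /block /height /column /= !eqxx /=.
by rewrite (expander_next (connP n)) //; case/andP: h.
Qed.

(** The ancestral lines of any two vertices end in the blocks of index 0. *)
Lemma joined_all u v : joined edge u v.
Proof.
suff h w m : (level w + block w <= m)%N -> joined edge w (corner m 0).
  pose m := ((level u + block u) + (level v + block v))%N.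
  apply: joined_trans (h u m _) _; first by rewrite leq_addr.
  by apply: (joined_sym edge_sym); apply: h; rewrite leq_addl.
move=> wm; apply: joined_trans (joined_corner w) _.
have := joined_ancestor (level w) (block w) (m - level w).
rewrite subnKC ?(leq_trans _ wm) ?leq_addr// shiftr_divn divn_small//.
apply: leq_ltn_trans (ltn_expl _ (isT : 1 < 2)%N); lia.
Qed.

(** * Independence under the Bernoulli law *)
Section bernoulli_events.
Variables (R : realType) (p : R) (mu : probability config R).
Hypothesis p01 : 0 <= p <= 1.
Hypothesis muP : bernoulli_law p mu.
Implicit Types (O F : seq (nat * nat)) (Bs : seq (seq (nat * nat))).

(** The edges of O are open, and none of the sets of edges in Bs is entirely open. For
    disjoint sets of edges these events have an explicit probability, and they generate
    everything needed below: a closed edge is a set with one element. *)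
Definition avoiding O Bs : set config :=
  [set w : config | all w O && all (fun B => ~~ all w B) Bs].

Lemma measurable_all O : measurable [set w : config | all w O].
Proof.
elim: O => [|e O IH].
  by rewrite [X in measurable X](_ : _ = setT) //; apply/seteqP; split.
rewrite [X in measurable X](_ : _ = [set w : config | w e] `&` [set w : config | all w O]).
  apply: measurableI => //; apply: sub_sigma_algebra; by exists e.
by apply/seteqP; split => w /=; [move=> /andP|move=> ?; apply/andP].
Qed.

Lemma avoiding_cons O B Bs :
  avoiding O (B :: Bs) = avoiding O Bs `\` avoiding (O ++ B) Bs.
Proof.
apply/seteqP; split => w; rewrite /avoiding /= all_cat.
  by move=> /and3P[-> /negbTE -> ->].
move=> [/andP[-> ->]]; rewrite /= andbT => nB; rewrite andbT; exact/negP.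
Qed.

Lemma measurable_avoiding O Bs : measurable (avoiding O Bs).
Proof.
elim: Bs O => [|B Bs IH] O.
  rewrite [X in measurable X](_ : _ = [set w : config | all w O]); first exact: measurable_all.
  by apply/seteqP; split => w; rewrite /avoiding /= andbT.
by rewrite avoiding_cons; exact: measurableD.
Qed.

Lemma avoiding_sub O B Bs : avoiding (O ++ B) Bs `<=` avoiding O Bs.
Proof. by move=> w; rewrite /avoiding /= all_cat => /andP[/andP[-> _] ->]. Qed.

(** Induction on Bs: adding the constraint B removes the event that B is open as well. *)
Lemma measure_avoiding O Bs : uniq (O ++ flatten Bs) ->
  mu (avoiding O Bs) = (p ^+ size O * \prod_(B <- Bs) (1 - p ^+ size B))%:E.
Proof.
elim: Bs O => [|B Bs IH] O.
  rewrite /= cats0 big_nil mulr1 => /muP <-; congr (mu _).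
  by apply/seteqP; split => w; rewrite /avoiding /= andbT.
rewrite /= => u; rewrite avoiding_cons.
have -> : mu (avoiding O Bs `\` avoiding (O ++ B) Bs) =
    (mu (avoiding O Bs) - mu (avoiding (O ++ B) Bs))%E.
  rewrite (measureD (measurable_avoiding _ _) (measurable_avoiding _ _)).
    by rewrite setIidr//; exact: avoiding_sub.
  by rewrite ltey_eq fin_num_measure//; exact: measurable_avoiding.
rewrite !IH -?catA//; last first.
  by move: u; rewrite uniq_catCA => /subseq_uniq; apply; exact: suffix_subseq.
rewrite -EFinB; congr (_%:E); rewrite size_cat exprD big_cons; lra.
Qed.

(** A partly explored set of edges: those of O are open, those of Cl are closed and those
    of F are unknown; T is a family of tests chosen according to all the open edges. *)
Let explored O Cl F (T : seq (nat * nat) -> seq (seq (nat * nat))) : set config :=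
  [set w : config | [&& all w O, all (fun e => ~~ w e) Cl
     & all (fun B => ~~ all w B) (T (O ++ [seq e <- F | w e]))]].

Lemma singletons_closed (w : config) Cl :
  all (fun B => ~~ all w B) [seq [:: e] | e <- Cl] = all (fun e => ~~ w e) Cl.
Proof. by rewrite all_map; apply: eq_all => e /=; rewrite andbT. Qed.

Let explored_le O Cl F T q :
  uniq (O ++ Cl ++ F) ->
  (forall A, {subset A <= O ++ Cl ++ F} -> uniq A ->
     uniq (flatten (T A)) /\ (forall e, e \in O ++ Cl ++ F -> e \notin flatten (T A))) ->
  (forall A, {subset A <= O ++ Cl ++ F} -> uniq A ->
     \prod_(B <- T A) (1 - p ^+ size B) <= q) ->
  measurable (explored O Cl F T) /\
  (mu (explored O Cl F T) <= mu (avoiding O [seq [:: e] | e <- Cl]) * q%:E)%E.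
Proof.
elim: F O Cl => [|e F IH] O Cl u Bu Bq.
  have -> : explored O Cl [::] T = avoiding O ([seq [:: e] | e <- Cl] ++ T O).
    apply/seteqP; split => w; rewrite /explored /avoiding /= all_cat singletons_closed cats0;
    by [move=> /and3P[-> -> ->]|move=> /and3P[-> -> ->]].
  have fl : flatten [seq [:: e] | e <- Cl] = Cl.
    by elim: (Cl) => //= e s ->.
  rewrite cats0 in u Bu Bq.
  have OO : {subset O <= O ++ Cl} by move=> x xO; rewrite mem_cat xO.
  have uO : uniq O by move: u; rewrite cat_uniq => /andP[].
  have [u1 u2] := Bu O OO uO.
  split; first exact: measurable_avoiding.
  have u3 : uniq (O ++ flatten ([seq [:: e] | e <- Cl] ++ T O)).
    rewrite flatten_cat fl catA cat_uniq u u1 andbT /=.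
    by apply/hasPn => x; apply: contraL => xOC; exact: u2.
  rewrite !measure_avoiding ?fl// -EFinM lee_fin -mulrA big_cat /=.
  rewrite ler_wpM2l ?exprn_ge0//; first by case/andP: p01.
  apply: ler_wpM2l; last exact: Bq.
  apply: prodr_ge0 => B _; rewrite subr_ge0 exprn_ile1//; by case/andP: p01.
have splitE : explored O Cl (e :: F) T =
    explored (rcons O e) Cl F T `|` explored O (rcons Cl e) F T.
  apply/seteqP; split => w; rewrite /explored /= !all_rcons.
    by case: ifP => we; rewrite ?cat_rcons => /and3P[-> -> ->]; [left|right].
  case=> /and3P[].
    by move=> /andP[we ->] ->; rewrite we cat_rcons.
  by move=> -> /andP[/negbTE we ->]; rewrite we.
have p0 : 0 <= p by case/andP: p01.
have cat_e x : (x \in O ++ Cl ++ e :: F) = (x == e) || (x \in O ++ Cl ++ F).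
  by rewrite !mem_cat in_cons; do 3 case: (_ \in _); rewrite ?orbT ?orbF.
have [m1 le1] : measurable (explored (rcons O e) Cl F T) /\
    (mu (explored (rcons O e) Cl F T) <=
       mu (avoiding (rcons O e) [seq [:: e] | e <- Cl]) * q%:E)%E.
  have memE x : (x \in rcons O e ++ Cl ++ F) = (x \in O ++ Cl ++ e :: F).
    by rewrite cat_e mem_cat mem_rcons in_cons -orbA -mem_cat.
  apply: IH.
  - rewrite (perm_uniq (s2 := O ++ Cl ++ e :: F))// cat_rcons perm_cat2l.
    by rewrite -(cat1s e (Cl ++ F)) -(cat1s e F) perm_catCA.
  - move=> A AO uA; have [|u1 u2] := Bu A _ uA; first by move=> x /AO; rewrite memE.
    by split=> // x; rewrite memE; exact: u2.
  - by move=> A AO uA; apply: Bq => // x /AO; rewrite memE.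
have [m2 le2] : measurable (explored O (rcons Cl e) F T) /\
    (mu (explored O (rcons Cl e) F T) <=
       mu (avoiding O [seq [:: e] | e <- rcons Cl e]) * q%:E)%E.
  by apply: IH; rewrite cat_rcons.
rewrite splitE; split; first exact: measurableU.
have uO : uniq (O ++ e :: Cl).
  move: u; rewrite catA cat_uniq => /and3P[u uF _].
  rewrite -(cat1s e) uniq_catCA cat1s /= u andbT.
  by apply: contra uF => eOC; apply/hasP; exists e => //; rewrite inE eqxx.
apply: le_trans (measureU2 _ m1 m2) _.
apply: le_trans (leeD le1 le2) _.
have fl (A : seq (nat * nat)) : flatten [seq [:: e] | e <- A] = A.
  by elim: A => //= x s ->.
rewrite !measure_avoiding ?fl ?cat_rcons// -?catA//; last first.
- by rewrite (perm_uniq (s2 := O ++ e :: Cl))// perm_cat2l perm_rcons.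
- by move: uO; rewrite -(cat1s e) uniq_catCA cat1s /= => /andP[].
rewrite -!EFinM -EFinD lee_fin -[rcons Cl e]cats1 map_cat big_cat /= big_seq1 size_rcons exprSr.
lra.
Qed.

(** Tests that depend on the open edges of F but concern other edges fail with probability
    at most q, if they do so for each fixed outcome on F. This is the independence of
    the columns from the connectors; it is proved by revealing the edges of F one by
    one. *)
Lemma explored_event_le F (T : seq (nat * nat) -> seq (seq (nat * nat))) q :
  uniq F ->
  (forall A, {subset A <= F} -> uniq A -> [/\ uniq (flatten (T A)),
     forall e, e \in F -> e \notin flatten (T A) &
     \prod_(B <- T A) (1 - p ^+ size B) <= q]) ->
  let E := [set w : config | all (fun B => ~~ all w B) (T [seq e <- F | w e])] in
  measurable E /\ (mu E <= q%:E)%E.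
Proof.
move=> uF TP E.
have : measurable (explored [::] [::] F T) /\
    (mu (explored [::] [::] F T) <= mu (avoiding [::] [seq [:: e] | e <- [::]]) * q%:E)%E.
  apply: explored_le => // A AF uA; first by have [? ? _] := TP A AF uA.
  by have [_ _] := TP A AF uA.
rewrite (measure_avoiding (O := [::]) (Bs := [::]))//= big_nil expr0 mul1r mul1e.
exact.
Qed.

End bernoulli_events.

(** * Coordinates *)
Lemma valid_cell0 : valid_cell (0%N, 0%N, 0%N).
Proof. exact: valid_corner. Qed.

(** A total function of the coordinates, which spares carrying validity proofs. *)
Definition vtx n x j a : vertex := (insubd (Sub _ valid_cell0 : cell) (n, x, j), a).

Lemma val_vtx n x j a : valid_cell (n, x, j) -> val (vtx n x j a).1 = (n, x, j).
Proof. by move=> h; rewrite insubdK. Qed.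

Lemma vtxK u : vtx (level u) (column u) (height u) (block u) = u.
Proof.
have h : valid_cell (level u, column u, height u).
  by rewrite /valid_cell /= column_lt height_le.
by apply: vertex_eq; rewrite /level /column /height /block ?val_vtx.
Qed.

Lemma vtx_coord n x j a (u := vtx n x j a) : (x < width n)%N -> (j <= n)%N ->
  [/\ level u = n, column u = x, height u = j & block u = a].
Proof.
move=> xn jn; have h : valid_cell (n, x, j) by rewrite /valid_cell /= xn.
by rewrite /level /column /height val_vtx.
Qed.

Lemma next_vtx n x j a : (x < width n)%N -> (j < n)%N ->
  next_vertex (vtx n x j a) = vtx n x j.+1 a.
Proof.
move=> xn jn; have [l c h b] := vtx_coord a xn (ltnW jn).
have [l' c' h' b'] := vtx_coord a xn jn.
have [[_ [? ? ? ?]]|[e _]] := next_vertexP (vtx n x j a); first by apply: vertex_eq; congruence.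
by move: jn; rewrite -[X in (X < _)%N]h -[X in (_ < X)%N]l e ltnn.
Qed.

Lemma next_vtx_top n x a : (x < width n)%N ->
  next_vertex (vtx n x n a) = vtx n.+1 x 0 (Nat.shiftr a 3).
Proof.
move=> xn; have [l c h b] := vtx_coord a xn (leqnn n).
have [//|l' c' h' b'] := @vtx_coord n.+1 x 0%N (Nat.shiftr a 3) (leq_trans xn (leq_widthS n)).
have [[e _]|[_ [? ? ? ?]]] := next_vertexP (vtx n x n a); last by apply: vertex_eq; congruence.
by move: e; rewrite h l ltnn.
Qed.

(** * Clusters of a copy of the canopy *)
Section percolation.
Variables (H : graph) (phi : vertex -> vert H).
Hypothesis phi_inj : injective phi.
Hypothesis phi_surj : forall y, exists u, phi u = y.
Hypothesis phi_adj : forall u v, adj H (phi u) (phi v) = edge u v.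

Definition state_of u v : nat * nat := edge_index (val (phi u)) (val (phi v)).

Lemma state_ofC u v : state_of u v = state_of v u.
Proof. by rewrite /state_of /edge_index minnC maxnC. Qed.

Lemma state_of_inj u v u' v' : state_of u v = state_of u' v' ->
  (u = u' /\ v = v') \/ (u = v' /\ v = u').
Proof.
have vI := inj_comp val_inj phi_inj.
rewrite /state_of /edge_index => -[].
case: (leqP (val (phi u)) (val (phi v))) => _;
case: (leqP (val (phi u')) (val (phi v'))) => _ /vI ? /vI ?; by [left|right].
Qed.

Definition opens (w : config) : rel vertex := [rel u v | edge u v && w (state_of u v)].

Lemma open_adj_phi w u v : open_adj w (phi u) (phi v) = opens w u v.
Proof. by rewrite /open_adj phi_adj. Qed.

Definition up_state u := state_of u (next_vertex u).

Lemma up_state_inj : injective up_state.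
Proof.
move=> u v /state_of_inj[[//]|[uE vE]].
have := next_vertexP u; have := next_vertexP v; rewrite -uE vE.
by case=> [[_ []]|[_ []]] ? ? ? ?; case=> [[_ []]|[_ []]] ? ? ? ?; lia.
Qed.

Lemma finite_cluster w (S : set vertex) v :
  finite_set S -> S v -> (forall u u', S u -> opens w u u' -> S u') ->
  finite_set (@Defs.cluster (open_subgraph H w) (phi v)).
Proof.
move=> Sfin Sv Scl; apply: (@sub_finite_set _ _ (phi @` S)); last exact: finite_image.
move=> y [p [vp <-]]; elim: p v Sv vp => [|z p IH] v Sv /=; first by move=> _; exists v.
have [z' <-] := phi_surj z; rewrite open_adj_phi => /andP[vz]; exact/IH/(Scl v).
Qed.

Lemma infinite_cluster w (f : nat -> vertex) : injective f ->
  (forall n, joined (opens w) (f 0%N) (f n)) -> has_infinite_cluster (open_subgraph H w).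
Proof.
move=> fI fj; exists (phi (f 0%N)); apply: (@sub_infinite_set _ (range (phi \o f))).
  move=> _ [n _ <-] /=; have [p [up <-]] := fj n.
  exists (map phi p); split; last by rewrite last_map.
  rewrite path_map; apply: sub_path up => a b /=; by rewrite open_adj_phi.
rewrite (eq_finite_set (inj_card_eq _)); first exact: infinite_nat.
by move=> a b _ _ /phi_inj/fI.
Qed.

Definition column_states m x := [seq up_state (vtx m x j 0) | j <- iota 0 m.+1].

Lemma size_column_states m x : size (column_states m x) = m.+1.
Proof. by rewrite size_map size_iota. Qed.

Lemma mem_column_states m x e : reflect
  (exists2 j, (j <= m)%N & e = up_state (vtx m x j 0)) (e \in column_states m x).
Proof.
apply: (iffP mapP) => -[j jm ->]; exists j => //; move: jm; by rewrite mem_iota ltnS.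
Qed.

Lemma uniq_column_states m x : (x < width m)%N -> uniq (column_states m x).
Proof.
move=> xm; rewrite map_inj_in_uniq ?iota_uniq// => i j.
rewrite !mem_iota !ltnS => /= im jm /up_state_inj ij.
have [_ _ <- _] := vtx_coord 0 xm im; have [_ _ <- _] := vtx_coord 0 xm jm.
by rewrite ij.
Qed.

Lemma open_column_joined w m x : (x < width m)%N -> all w (column_states m x) ->
  joined (opens w) (vtx m x 0 0) (vtx m.+1 x 0 0).
Proof.
move=> xm /allP op.
have opn j : (j <= m)%N -> opens w (vtx m x j 0) (next_vertex (vtx m x j 0)).
  move=> jm; rewrite /opens /= edge_next; apply: op.
  by apply/mem_column_states; exists j.
have h j : (j <= m)%N -> joined (opens w) (vtx m x 0 0) (vtx m x j 0).
  elim: j => [|j IH] jm; first exact: joined_refl.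
  apply: joined_trans (IH (ltnW jm)) _; rewrite -next_vtx//.
  exact/joined1/opn/ltnW.
apply: joined_trans (h m (leqnn m)) _; rewrite -(next_vtx_top 0 xm).
exact/joined1/opn.
Qed.

(** The vertices that a cluster started below level m can reach without following a whole
    column of block 0 of level m. *)
Definition below m w : set vertex := [set u | [/\ (level u <= m)%N,
  Nat.shiftr (block u) (3 * (m - level u)) = 0%N &
  level u = m -> forall j, (j < height u)%N -> w (up_state (vtx m (column u) j 0))]].

Lemma finite_below m w : finite_set (below m w).
Proof.
apply: (@sub_finite_set _ _ ((fun q : 'I_m.+1 * 'I_(width m) * 'I_m.+1 * 'I_(2 ^ (3 * m)) =>
   vtx q.1.1.1 q.1.1.2 q.1.2 q.2) @` setT)); last exact/finite_image/finite_finset.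
move=> u [lm bm _].
have cu : (column u < width m)%N.
  apply: leq_trans (column_lt u) _; rewrite -(subnKC lm).
  by elim: (m - _)%N => [|k IH]; rewrite ?addn0// addnS (leq_trans IH)// leq_widthS.
have hu : (height u < m.+1)%N by rewrite ltnS (leq_trans (height_le u)).
have bu : (block u < 2 ^ (3 * m))%N.
  have : (block u < 2 ^ (3 * (m - level u)))%N.
    by rewrite -[X in (_ < X)%N]mul1n -ltn_divLR ?expn_gt0// -shiftr_divn bm.
  by move=> /leq_trans; apply; rewrite leq_exp2l// leq_mul2l leq_subr orbT.
exists (Ordinal (lm : (level u < m.+1)%N), Ordinal cu, Ordinal hu, Ordinal bu) => //=.
exact: vtxK.
Qed.

(** The block is left only from the top of a column, all of whose edges below are open by
    definition of the set; the last edge being open too, the column would be open. *)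
Lemma below_closed m w u v :
  ~~ has (fun x => all w (column_states m x)) (iota 0 (width m)) ->
  below m w u -> opens w u v -> below m w v.
Proof.
move=> /hasPn noc [lu bu hu] /andP[/or3P[cuv|/eqP vE|/eqP uE] wuv].
- move: cuv; rewrite /edge_conn => /and5P[/eqP luv /eqP buv _ /eqP hv _].
  split; rewrite -?luv -?buv// => _ j.
  by rewrite hv.
- have wu : w (up_state u) by rewrite /up_state -vE.
  have uvtx : level u = m -> u = vtx m (column u) (height u) 0.
    move=> lm; move: bu; rewrite lm subnn muln0 => bu.
    by rewrite -[LHS]vtxK lm [block u]bu.
  have := next_vertexP u; rewrite -vE => -[[hlt [lv cv hv bv]]|[heq [lv cv hv bv]]].
    split; rewrite ?lv ?bv// => lm j; rewrite cv hv ltnS leq_eqVlt.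
    by move=> /predU1P[->|]; [rewrite -uvtx|exact: hu].
  have [lm|lm] := eqVneq (level u) m; last first.
    have {}lm : (level u < m)%N by rewrite ltn_neqAle lm.
    split; rewrite lv// ?hv//.
    rewrite bv PeanoNat.Nat.shiftr_shiftr -[RHS]bu; congr Nat.shiftr; lia.
  exfalso; have := noc (column u).
  rewrite mem_iota leq0n add0n -{1}lm column_lt => /(_ isT)/negP; apply.
  apply/allP => _ /mem_column_states[j jm ->]; move: jm; rewrite leq_eqVlt => /predU1P[->|jm].
    have e : vtx m (column u) m 0 = u by rewrite [RHS](uvtx lm) heq lm.
    by rewrite e.
  by apply: hu => //; rewrite heq lm.
- have := next_vertexP v; rewrite -uE => -[[hlt [lv cv hv bv]]|[heq [lv cv hv bv]]].
    rewrite lv bv cv hv in lu bu hu; split=> // lm j jv; apply: hu => //; exact: leqW.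
  split; first by rewrite lv in lu; exact: ltnW.
    rewrite -[RHS]bu lv bv PeanoNat.Nat.shiftr_shiftr; congr Nat.shiftr; rewrite lv in lu; lia.
  by move=> lm; rewrite lv lm ltnn in lu.
Qed.

(** An infinite cluster leaves the descendants of each of its ancestral blocks, and these
    have index 0 from some level on. *)
Lemma infinite_cluster_columns w : has_infinite_cluster (open_subgraph H w) ->
  exists m0, forall m, (m0 <= m)%N ->
    has (fun x => all w (column_states m x)) (iota 0 (width m)).
Proof.
move=> [y]; have [v <-] := phi_surj y => vinf.
exists (level v + block v).+1 => m lm; apply/contraT => noc; exfalso; apply: vinf.
apply: (@finite_cluster w (below m w)).
- exact: finite_below.
- split.
  + by apply: leq_trans lm; rewrite leqW// leq_addr.
  + rewrite shiftr_divn divn_small//; apply: leq_ltn_trans (ltn_expl _ (isT : 1 < 2)%N); lia.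
  + by move=> lv; rewrite -lv in lm; exfalso; lia.
- move=> u u'; exact: below_closed.
Qed.

End percolation.

(** * Estimates *)
Lemma measure_lim_sup_set0 d (T : measurableType d) (R : realType)
    (mu : {measure set T -> \bar R}) (E : (set T)^nat) (C s : R) :
  (forall n, measurable (E n)) -> 0 <= C -> 0 <= s < 1 ->
  (forall n, (mu (E n) <= (C * s ^+ n)%:E)%E) -> mu (lim_sup_set E) = 0.
Proof.
move=> mE C0 /andP[s0 s1] muE; apply: lim_sup_set_cvg0 => //.
apply: le_lt_trans (_ : (C / (1 - s))%:E < +oo)%E; last exact: ltry.
apply: lime_le; first exact: is_cvg_nneseries.
apply: nearW => n; apply: le_trans (lee_sum _ (fun i _ => muE i)) _.
rewrite sumEFin lee_fin -mulr_sumr ler_wpM2l//.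
have geo : (\sum_(0 <= i < n) s ^+ i) * (1 - s) = 1 - s ^+ n.
  elim: n => [|n IH]; first by rewrite big_geq// mul0r expr0 subrr.
  by rewrite big_nat_recr//= mulrDl IH exprS; lra.
rewrite -[leRHS]mul1r ler_pdivlMr ?subr_gt0// geo.
by rewrite gerBl exprn_ge0.
Qed.

(** n t^n is at most the sum of the t^k for k < n, which is (1 - t^n) / (1 - t). *)
Lemma natmul_exp_le (R : realType) (t : R) n : 0 <= t <= 1 ->
  n%:R * t ^+ n * (1 - t) <= 1 - t ^+ n.
Proof.
move=> /andP[t0 t1]; elim: n => [|n IH]; first by rewrite !mul0r expr0 subrr.
have tn0 : 0 <= t ^+ n by exact: exprn_ge0.
have tn1 : t ^+ n <= 1 by exact: exprn_ile1.
have h1 := ler_wpM2l t0 IH.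
have h2 : 0 <= (1 - t) * (1 - t * t ^+ n).
  by apply: mulr_ge0; rewrite subr_ge0//; nra.
rewrite -natr1 exprS; lra.
Qed.

(** (1 - x)^K (1 + x)^K is at most 1, and (1 + x)^K is at least 1 + K x, hence at least
    2. *)
Lemma expr_onem_le_half (R : realType) (x : R) K :
  0 <= x <= 1 -> 1 <= K%:R * x -> (1 - x) ^+ K <= 2^-1.
Proof.
move=> /andP[x0 x1] Kx.
have b n : 1 + n%:R * x <= (1 + x) ^+ n.
  elim: n => [|n IH]; first by rewrite mul0r addr0 expr0.
  have n0 : 0 <= n%:R :> R by []. 
  by rewrite exprS -natr1; nra.
have : (1 - x) ^+ K * (1 + x) ^+ K <= 1.
  by rewrite -exprMn exprn_ile1//; nra.
have := b K; have : 0 <= (1 - x) ^+ K by rewrite exprn_ge0// subr_ge0.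
nra.
Qed.

Section threshold.
Variable R : realType.

(** The critical probability of the canopy: 1 - p0 = 1/32 is less than 1/16, as the union
    bound over the 2^(4 M) cuts with M closed edges requires. *)
Definition p0 : R := 31 / 32.

Lemma p0_itv : 0 < p0 < 1. Proof. by rewrite /p0; lra. Qed.

Let ratio n : R := (32 ^ n)%:R / (31 ^ n)%:R.

Let p0X n : p0 ^+ n * ratio n = 1.
Proof.
rewrite /p0 /ratio !natrX expr_div_n mulrA divfK ?divff//; by rewrite expf_neq0.
Qed.

Lemma quarter_factor_ge n : 1 <= (32 ^ n.+1 %/ 31 ^ n.+1 + 1)%:R * p0 ^+ n.+1.
Proof.
have /andP[p00 _] := p0_itv.
rewrite -[leLHS](p0X n.+1) [leLHS]mulrC ler_pM2r ?exprn_gt0// /ratio ler_pdivrMr ?ltr0n ?expn_gt0//.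
by rewrite -natrM ler_nat addn1 ltnW// ltn_ceil ?expn_gt0.
Qed.

Lemma quarter_mean_le n : (quarter n)%:R * p0 ^+ n.+1 <= n.+1%:R * 2.
Proof.
have /andP[p00 p01] := p0_itv; rewrite /quarter natrM -mulrA ler_wpM2l//.
have -> : 2 = 2 * (p0 ^+ n.+1 * ratio n.+1) :> R by rewrite p0X mulr1.
rewrite mulrCA [leLHS]mulrC ler_wpM2l ?exprn_ge0 ?(ltW p00)//.
have r1 : 1 <= ratio n.+1.
  by rewrite /ratio ler_pdivlMr ?ltr0n ?expn_gt0// mul1r ler_nat leq_exp2r.
have rq : (32 ^ n.+1 %/ 31 ^ n.+1)%:R <= ratio n.+1.
  by rewrite /ratio ler_pdivlMr ?ltr0n ?expn_gt0// -natrM ler_nat leq_divM.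
by rewrite natrD; lra.
Qed.

(** The expected number of open columns of a block is at most of order n (p / p0)^n; with
    t^2 = p / p0, one factor t^n absorbs n and the other one gives a geometric decay. *)
Lemma bottleneck_mean_le (p : R) : 0 <= p < p0 ->
  exists C t, [/\ 0 <= C, 0 <= t < 1 & forall n, (width n)%:R * p ^+ n.+1 <= C * t ^+ n].
Proof.
move=> /andP[p_ge0 pp0]; have /andP[p00 p01] := p0_itv.
pose r := p / p0; pose t := Num.sqrt r.
have r0 : 0 <= r by rewrite divr_ge0// ltW.
have r1 : r < 1 by rewrite ltr_pdivrMr// mul1r.
have t0 : 0 <= t by exact: sqrtr_ge0.
have t1 : t < 1 by rewrite -sqrtr1 ltr_sqrt.
have rt : r = t * t by rewrite -expr2 sqr_sqrtr.
exists (8 / (1 - t)), t; split; [by rewrite divr_ge0//; lra|by rewrite t0|move=> n].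
have pE : p ^+ n.+1 = p0 ^+ n.+1 * (t ^+ n.+1 * t ^+ n.+1).
  by rewrite -!exprMn -rt /r mulrCA divff ?mulr1// gt_eqF.
rewrite /width natrM pE.
have q := quarter_mean_le n.
have tn0 : 0 <= t ^+ n.+1 by exact: exprn_ge0.
have tn : t ^+ n.+1 <= t ^+ n by rewrite exprS ler_piMl ?exprn_ge0 ?(ltW t1).
have t01 : 0 <= t <= 1 by rewrite t0 (ltW t1).
have nt := natmul_exp_le n.+1 t01.
have {}nt : n.+1%:R * t ^+ n.+1 <= 1 / (1 - t).
  by rewrite ler_pdivlMr ?subr_gt0// (le_trans nt)// gerBl.
apply: (@le_trans _ _ (8 * (n.+1%:R * t ^+ n.+1) * t ^+ n.+1)).
  have : (quarter n)%:R * p0 ^+ n.+1 * (t ^+ n.+1 * t ^+ n.+1) <=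
     n.+1%:R * 2 * (t ^+ n.+1 * t ^+ n.+1) by rewrite ler_wpM2r// mulr_ge0.
  move: (quarter n)%:R (p0 ^+ n.+1) (t ^+ n.+1) n.+1%:R => a b c d; lra.
apply: ler_pM => //; first by rewrite mulr_ge0// mulr_ge0.
by lra.
Qed.

(** The probability that quarter n columns are all closed at p0. They form n + 1 groups in
    each of which the mean number of open columns is at least 1. *)
Lemma bottleneck_fail_le n : (1 - p0 ^+ n.+1) ^+ quarter n <= 2^-1 ^+ n.+1.
Proof.
have /andP[p00 p01] := p0_itv.
rewrite /quarter mulnC exprM.
have x01 : 0 <= p0 ^+ n.+1 <= 1.
  by rewrite exprn_ge0 ?(ltW p00)//= exprn_ile1 ?(ltW p00) ?(ltW p01).
apply: lerXn2r; rewrite ?nnegrE ?invr_ge0//.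
  by rewrite exprn_ge0// subr_ge0; case/andP: x01.
exact: expr_onem_le_half (quarter_factor_ge n).
Qed.

End threshold.

(** * No percolation below p0 *)
Section unions.
Variables (R : realType) (mu : probability config R).

Lemma union_bound (I : Type) (s : seq I) (E : I -> set config) (q : R) :
  (forall i, measurable (E i)) -> (forall i, (mu (E i) <= q%:E)%E) ->
  measurable (\big[setU/set0]_(i <- s) E i) /\
  (mu (\big[setU/set0]_(i <- s) E i) <= ((size s)%:R * q)%:E)%E.
Proof.
move=> mE qE; elim: s => [|i s [ms les]].
  by rewrite big_nil measure0 mul0r.
rewrite big_cons; split; first exact: measurableU.
apply: le_trans (measureU2 _ (mE i) ms) _.
by apply: le_trans (leeD (qE i) les) _; rewrite -EFinD lee_fin /= -natr1; lra.
Qed.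

Lemma mem_unionP (I : choiceType) (s : seq I) (E : I -> set config) w :
  (\big[setU/set0]_(i <- s) E i) w <-> exists2 i, i \in s & E i w.
Proof.
by rewrite -bigcup_seq; split=> -[i]; exists i.
Qed.

Lemma measurable_lim_sup_set (E : (set config)^nat) :
  (forall n, measurable (E n)) -> measurable (lim_sup_set E).
Proof.
by move=> mE; apply: bigcapT_measurable => n; exact: bigcup_measurable.
Qed.
End unions.

Section subcritical.
Variables (R : realType) (H : graph) (phi : vertex -> vert H).
Hypothesis phi_inj : injective phi.
Hypothesis phi_surj : forall y, exists u, phi u = y.
Hypothesis phi_adj : forall u v, adj H (phi u) (phi v) = edge u v.

Lemma not_percolates_lt_p0 (p : R) : 0 <= p < p0 R -> ~ percolates H p.
Proof.
move=> /andP[p_ge0 pp0] perc.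
have p01 : 0 <= p <= 1.
  by rewrite p_ge0 (ltW (lt_trans pp0 _))//; case/andP: (p0_itv R).
set mu := bernoulli_measure p in perc; have muP : bernoulli_law p mu := bernoulli_measureP p01.
pose E m := \big[setU/set0]_(x <- iota 0 (width m))
  (if (x < width m)%N then [set w : config | all w (column_states phi m x)] else set0).
have Ebound m : measurable (E m) /\ (mu (E m) <= ((width m)%:R * p ^+ m.+1)%:E)%E.
  rewrite -[X in (X%:R * _)](size_iota 0); apply: union_bound => x; case: ifP => // xm.
  - exact: measurable_all.
  - by rewrite muP ?uniq_column_states// size_column_states.
  - by rewrite measure0 lee_fin exprn_ge0.
have [C [t [C0 t01 Ct]]] : exists C t, [/\ 0 <= C, 0 <= t < 1 &
    forall n, (width n)%:R * p ^+ n.+1 <= C * t ^+ n].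
  by apply: bottleneck_mean_le; rewrite p_ge0.
have null : mu (lim_sup_set E) = 0.
  apply: (measure_lim_sup_set0 (C := C) (s := t)) => // n; first by have [] := Ebound n.
  by have [_ /le_trans] := Ebound n; apply; rewrite lee_fin.
have inf_sub : [set w | has_infinite_cluster (open_subgraph H w)] `<=` lim_sup_set E.
  move=> w /(infinite_cluster_columns phi_surj phi_adj)[m0 m0P] n _.
  exists (maxn n m0); first exact: leq_maxl.
  have /hasP[x xi xo] := m0P _ (leq_maxr n m0).
  rewrite /E; move: (xi); rewrite mem_iota /= add0n => xm.
  by apply/mem_unionP; exists x; rewrite ?xm.
have : mu.-negligible [set: config].
  pose I := [set w | has_infinite_cluster (open_subgraph H w)].
  apply: (@negligibleS _ _ _ mu (~` I `|` lim_sup_set E)).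
    by move=> w _; have [/inf_sub|] := pselect (I w); [right|left].
  apply: negligibleU => //; exists (lim_sup_set E); split => //.
  by apply: measurable_lim_sup_set => n; have [] := Ebound n.
move=> neg; have h0 : mu [set: config] = 0%E by exact: measure_negligible.
have h1 : mu [set: config] = 1%E by exact: probability_setT.
by move: h0; rewrite h1 => /eqP; rewrite eqe oner_eq0.
Qed.

End subcritical.

(** * Giant clusters of the connectors *)
Section critical.
Variables (H : graph) (phi : vertex -> vert H).
Hypothesis phi_inj : injective phi.
Hypothesis phi_adj : forall u v, adj H (phi u) (phi v) = edge u v.

Definition conn_state m x y := state_of phi (vtx m x 0 0) (vtx m y 0 0).

Definition open_conn (w : config) m : rel 'I_(width m) :=
  [rel x y : 'I_(width m) | conn m x y && w (conn_state m x y)].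

Arguments open_conn : clear implicits.

Lemma open_conn_sym w m : symmetric (open_conn w m).
Proof.
by move=> x y; rewrite /open_conn /= (expander_sym (connP m)) /conn_state state_ofC.
Qed.

(** Membership in a cluster with more than three quarters of the connector of block 0 of
    level m; any two such clusters meet. Labels are natural numbers because they are
    compared between levels. *)
Definition in_giant (w : config) m (x : nat) : bool :=
  if insub x is Some i
  then (3 * quarter m < #|finset (connect (open_conn w m) i)|)%N else false.

Lemma in_giantE w m (x : 'I_(width m)) :
  in_giant w m x = (3 * quarter m < #|finset (connect (open_conn w m) x)|)%N.
Proof. by rewrite /in_giant valK. Qed.

Lemma conn_state_inj m x y x' y' : (x < width m)%N -> (y < width m)%N ->
  (x' < width m)%N -> (y' < width m)%N ->
  conn_state m x y = conn_state m x' y' ->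
  (x = x' /\ y = y') \/ (x = y' /\ y = x').
Proof.
move=> xm ym xm' ym'.
have [_ c1 _ _] := vtx_coord 0 xm (leq0n m); have [_ c2 _ _] := vtx_coord 0 ym (leq0n m).
have [_ c3 _ _] := vtx_coord 0 xm' (leq0n m); have [_ c4 _ _] := vtx_coord 0 ym' (leq0n m).
by move=> /(state_of_inj phi_inj)[[e1 e2]|[e1 e2]]; [left|right];
  split; congruence.
Qed.

Lemma conn_state_neq_up m x y u : (x < width m)%N -> (y < width m)%N ->
  conn_state m x y != up_state phi u.
Proof.
move=> xm ym; apply/eqP => /(state_of_inj phi_inj).
have [l1 _ h1 _] := vtx_coord 0 xm (leq0n m); have [l2 _ h2 _] := vtx_coord 0 ym (leq0n m).
by have := next_vertexP u; case=> [[_ []]|[_ []]] ? ? ? ? [[e1 e2]|[e1 e2]];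
  rewrite e1 in l1 h1; rewrite e2 in l2 h2; lia.
Qed.

Lemma conn_joined w m (x y : 'I_(width m)) : connect (open_conn w m) x y ->
  joined (opens phi w) (vtx m x 0 0) (vtx m y 0 0).
Proof.
move=> /connectP[p]; elim: p x => [|z p IH] x /=; first by move=> _ ->; exact: joined_refl.
move=> /andP[/andP[xz wxz] zp] yE; apply: joined_trans (joined1 _) (IH z zp yE).
rewrite /opens /= wxz andbT.
have [l1 c1 h1 b1] := vtx_coord 0 (ltn_ord x) (leq0n m).
have [l2 c2 h2 b2] := vtx_coord 0 (ltn_ord z) (leq0n m).
by rewrite /edge /edge_conn l1 l2 c1 c2 h1 h2 b1 b2 !eqxx xz.
Qed.

Lemma in_giant_joined w m x y : in_giant w m x -> in_giant w m y ->
  joined (opens phi w) (vtx m x 0 0) (vtx m y 0 0).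
Proof.
rewrite /in_giant; case: insubP => // i _ <- xg; case: insubP => // j _ <- yg.
apply: conn_joined.
exact: (@giant_components_meet _ _ (quarter m)) (@open_conn_sym w m) (card_ord _) xg yg.
Qed.

Definition cut_open (w : config) m : Prop := forall S : {set 'I_(width m)},
  (quarter m <= #|S| <= 2 * quarter m)%N ->
  exists x y, [/\ x \in S, y \notin S & open_conn w m x y].

Lemma giant_count w m : cut_open w m ->
  (3 * quarter m < count (in_giant w m) (iota 0 (width m)))%N.
Proof.
move=> cut; have [x xg] :=
  exists_giant_component (@open_conn_sym w m) (quarter_gt0 m) (card_ord _) cut.
have -> : count (in_giant w m) (iota 0 (width m)) =
    #|finset (fun i : 'I_(width m) => in_giant w m i)|.
  by rewrite -val_enum_ord count_map cardsE cardE size_filter enumT.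
apply: (leq_trans xg); apply: subset_leq_card; apply/fintype.subsetP => y.
rewrite !finset.inE => xy; rewrite in_giantE; apply: (leq_trans xg).
apply: eq_leq; apply: eq_card => z; rewrite !finset.inE.
exact: (same_connect (sym_connect_sym (@open_conn_sym w m)) xy z).
Qed.

(** The columns of block 0 of level m that join the giant clusters of its connector and of
    the connector of its parent. *)
Definition good_columns w m : seq nat :=
  [seq x <- iota 0 (width m) | in_giant w m x && in_giant w m.+1 x].

(** Of the 4 M labels, fewer than M are missing from the lower giant cluster and fewer
    than 2 M from the upper one. *)
Lemma good_columns_size w m : cut_open w m -> cut_open w m.+1 ->
  (quarter m <= size (good_columns w m))%N.
Proof.
move=> /giant_count g1 /giant_count g2.
have h1 := count_predC (in_giant w m) (iota 0 (width m)).
have h2 := count_predC (in_giant w m.+1) (iota 0 (width m.+1)).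
have h3 := count_predC (fun x => in_giant w m x && in_giant w m.+1 x) (iota 0 (width m)).
rewrite !size_iota in h1 h2 h3.
have h4 : (count (predC (fun x => in_giant w m x && in_giant w m.+1 x)) (iota 0 (width m)) <=
    count (predC (in_giant w m)) (iota 0 (width m)) +
    count (predC (in_giant w m.+1)) (iota 0 (width m)))%N.
  rewrite -count_predUI; apply: leq_trans (leq_addr _ _).
  by apply: sub_count => x /=; rewrite negb_and.
have h5 : (count (predC (in_giant w m.+1)) (iota 0 (width m)) <=
    count (predC (in_giant w m.+1)) (iota 0 (width m.+1)))%N.
  have -> : iota 0 (width m.+1) = iota 0 (width m + (width m.+1 - width m)).
    by rewrite subnKC// leq_widthS.
  by rewrite iotaD count_cat leq_addr.
have := quarterS_leq m.
rewrite /good_columns size_filter; rewrite /width in g1 g2 h1 h2 h3 h4 h5 *; lia.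
Qed.

Lemma infinite_cluster_giants w m0 :
  (forall m, (m0 <= m)%N ->
     exists x, [/\ (x < width m)%N, in_giant w m x, in_giant w m.+1 x &
                   all w (column_states phi m x)]) ->
  has_infinite_cluster (open_subgraph H w).
Proof.
move=> h; have h' k : exists x, [/\ (x < width (m0 + k))%N, in_giant w (m0 + k) x,
    in_giant w (m0 + k).+1 x & all w (column_states phi (m0 + k) x)].
  exact/h/leq_addr.
have [X XP] := choice h'.
apply: (infinite_cluster phi_inj phi_adj (f := fun k => vtx (m0 + k) (X k) 0 0)).
  move=> i j e; have [xi _ _ _] := XP i; have [xj _ _ _] := XP j.
  have [l1 _ _ _] := vtx_coord 0 xi (leq0n _); have [l2 _ _ _] := vtx_coord 0 xj (leq0n _).
  by apply/eqP; rewrite -(eqn_add2l m0) -l1 -l2 e.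
elim=> [|k IH]; first exact: joined_refl.
apply: joined_trans IH _; have [xk _ g2 op] := XP k; have [_ g3 _ _] := XP k.+1.
rewrite addnS in g3 *; apply: joined_trans (open_column_joined xk op) _.
exact: in_giant_joined.
Qed.

End critical.

(** * Percolation at p0 *)
Section percolation_at_p0.
Variables (R : realType) (H : graph) (phi : vertex -> vert H).
Hypothesis phi_inj : injective phi.
Hypothesis phi_adj : forall u v, adj H (phi u) (phi v) = edge u v.

Let mu : probability config R := bernoulli_measure (p0 R).

Let p0_01 : 0 <= p0 R <= 1.
Proof. by have /andP[/ltW -> /ltW ->] := p0_itv R. Qed.

Let muP : bernoulli_law (p0 R) mu.
Proof. exact: bernoulli_measureP. Qed.

Section cuts.
Variable m : nat.
Implicit Types S : {set 'I_(width m)}.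

Definition cut_ends S : {set 'I_(width m)} :=
  finset (fun y => (y \notin S) && [exists x in S, conn m x y]).

Definition cut_origin S (y : 'I_(width m)) : 'I_(width m) :=
  odflt y [pick x in S | conn m x y].

(** One edge across the cut for each outer endpoint, which makes the edges distinct. *)
Definition cut_states S : seq (nat * nat) :=
  [seq conn_state phi m (cut_origin S y) y | y <- enum (cut_ends S)].

Lemma cut_originP S y : y \in cut_ends S ->
  [/\ cut_origin S y \in S, y \notin S & conn m (cut_origin S y) y].
Proof.
rewrite finset.inE => /andP[yS /exists_inP[x xS xy]]; rewrite /cut_origin.
by case: pickP => [z /andP[zS zy]|/(_ x)] //=; rewrite xS xy.
Qed.

Lemma uniq_cut_states S : uniq (cut_states S).
Proof.
rewrite map_inj_in_uniq ?enum_uniq// => y z; rewrite !mem_enum => yC zC.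
move=> /(conn_state_inj phi_inj (ltn_ord _) (ltn_ord _) (ltn_ord _) (ltn_ord _)).
have [oy ny _] := cut_originP yC; have [oz nz _] := cut_originP zC.
by case=> [[_ /val_inj//]|[/val_inj e _]]; rewrite e (negbTE nz) in oy.
Qed.

Lemma size_cut_states S : (quarter m <= #|S| <= 2 * quarter m)%N ->
  (quarter m <= size (cut_states S))%N.
Proof. by move=> /(expander_boundary (connP m)); rewrite size_map -cardE. Qed.

Definition closed_cut : set config := \big[setU/set0]_(S <- enum {: {set 'I_(width m)}})
  (if (quarter m <= #|S| <= 2 * quarter m)%N
   then avoiding [::] [seq [:: e] | e <- cut_states S] else set0).

Lemma not_closed_cut w : ~ closed_cut w -> cut_open phi w m.
Proof.
move=> ncut S Sm; apply: contrapT => nex; apply: ncut; apply/mem_unionP.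
exists S; rewrite ?mem_enum// Sm /avoiding /= singletons_closed.
apply/allP => _ /mapP[y yC ->]; rewrite mem_enum in yC; have [oy ny cy] := cut_originP yC.
by apply/negP => wy; apply: nex; exists (cut_origin S y), y; rewrite /open_conn /= cy.
Qed.

(** There are 2^(4 M) = 16^M sets S, each with M closed edges of probability 1/32 at its
    boundary. *)
Lemma closed_cut_le : measurable closed_cut /\ (mu closed_cut <= (2^-1 ^+ m.+1)%:E)%E.
Proof.
have [|S|mC leC] := @union_bound R mu _ (enum {: {set 'I_(width m)}}) (fun S =>
  if (quarter m <= #|S| <= 2 * quarter m)%N
  then avoiding [::] [seq [:: e] | e <- cut_states S] else set0) ((1 - p0 R) ^+ quarter m).
- by move=> S; case: ifP => // _; exact: measurable_avoiding.
- case: ifP => [Sm|_]; last by rewrite measure0 lee_fin exprn_ge0// subr_ge0; case/andP: p0_01.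
  have fl (A : seq (nat * nat)) : flatten [seq [:: e] | e <- A] = A.
    by elim: A => //= x s ->.
  rewrite (measure_avoiding muP) ?fl ?uniq_cut_states// lee_fin expr0 mul1r big_map.
  rewrite (eq_bigr (fun=> 1 - p0 R)); last by move=> e _; rewrite expr1.
  rewrite big_const_seq count_predT iter_mulr_1 ler_wiXn2l ?size_cut_states//.
    by rewrite subr_ge0; case/andP: p0_01.
  by rewrite gerBl; case/andP: p0_01.
split=> //; apply: le_trans leC _; rewrite lee_fin -cardE.
have -> : #|{: {set 'I_(width m)}}| = (2 ^ width m)%N.
  by rewrite -finset.cardsT -powersetT card_powerset finset.cardsT card_ord.
have -> : (2 ^ width m)%:R = 16 ^+ quarter m :> R.
  by rewrite /width expnM natrX; congr (_ ^+ _); rewrite natrX; lra.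
rewrite -exprMn (_ : 16 * (1 - p0 R) = 2^-1); last by rewrite /p0; lra.
apply: ler_wiXn2l; rewrite ?invr_ge0//; first by rewrite invf_le1//; lra.
by rewrite /quarter leq_pmulr// addn1.
Qed.

End cuts.

Section crossings.
Variable m : nat.

Definition conn_states n : seq (nat * nat) :=
  [seq conn_state phi n e.1 e.2 |
     e : 'I_(width n) * 'I_(width n) <- enum {: 'I_(width n) * 'I_(width n)} & conn n e.1 e.2].

Definition block_states : seq (nat * nat) := undup (conn_states m ++ conn_states m.+1).

Lemma mem_conn_states n (x y : 'I_(width n)) :
  conn n x y -> conn_state phi n x y \in conn_states n.
Proof. by move=> xy; apply/mapP; exists (x, y) => //; rewrite mem_filter xy mem_enum. Qed.

Lemma block_states_neq_up e u : e \in block_states -> e != up_state phi u.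
Proof.
rewrite mem_undup mem_cat => /orP[] /mapP[[x y] _ ->];
exact: (conn_state_neq_up phi_inj).
Qed.

(** The good columns are determined by the connector edges of the two levels, so that they
    can be computed from the finite list of the open ones. *)
Lemma in_giant_restrict w n x : {subset conn_states n <= block_states} ->
  in_giant phi (fun e => e \in [seq e <- block_states | w e]) n x = in_giant phi w n x.
Proof.
move=> sub; rewrite /in_giant; case: insubP => // i _ _; congr (_ < _)%N.
apply: eq_card => y; rewrite !finset.inE; apply: eq_connect => a b; rewrite /open_conn /=.
have [ab|//] := boolP (conn n a b).
by rewrite mem_filter sub ?andbT// mem_conn_states.
Qed.

Lemma good_columns_restrict w :
  good_columns phi (fun e => e \in [seq e <- block_states | w e]) m = good_columns phi w m.
Proof.
apply: eq_filter => x; rewrite !in_giant_restrict// => e he;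
by rewrite mem_undup mem_cat he ?orbT.
Qed.

(** When there are too few good columns, all columns are tested instead: the estimate then
    holds for every outcome on the connectors, and this case is excluded by open cuts. *)
Definition tested_columns (A : seq (nat * nat)) : seq nat :=
  let J := good_columns phi (fun e => e \in A) m in
  if (quarter m <= size J)%N then J else iota 0 (width m).

Definition closed_crossing : set config :=
  [set w : config | all (fun B => ~~ all w B)
     [seq column_states phi m x | x <- tested_columns [seq e <- block_states | w e]]].

Lemma uniq_columns s : uniq s -> {subset s <= iota 0 (width m)} ->
  uniq (flatten [seq column_states phi m x | x <- s]).
Proof.
elim: s => // x s IH; rewrite cons_uniq => /andP[xs us] sub; have xm : (x < width m)%N.
  by have := sub x (mem_head _ _); rewrite mem_iota.
rewrite -[flatten _]/(column_states phi m x ++ flatten [seq column_states phi m y | y <- s]).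
rewrite cat_uniq uniq_column_states// IH//; last by move=> y ys; apply: sub; rewrite inE ys orbT.
rewrite andTb andbT; apply/hasPn => e /flatten_mapP[y ys /mem_column_states[j jm ->]].
apply/negP => /mem_column_states[j' j'm /(up_state_inj phi_inj) e'].
have ym : (y < width m)%N by have := sub y; rewrite inE ys orbT mem_iota => /(_ isT).
have [_ c1 _ _] := vtx_coord 0 ym jm; have [_ c2 _ _] := vtx_coord 0 xm j'm.
by move: xs; rewrite -c2 -e' c1 ys.
Qed.

(** The tested columns are disjoint from the connectors and there are at least quarter m of
    them. *)
Lemma closed_crossing_le :
  measurable closed_crossing /\ (mu closed_crossing <= (2^-1 ^+ m.+1)%:E)%E.
Proof.
have x01 : 0 <= 1 - p0 R ^+ m.+1 <= 1.
  have /andP[p00 p01] := p0_01.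
  by rewrite subr_ge0 exprn_ile1//= gerBl exprn_ge0.
have tested A : [/\ uniq (tested_columns A), {subset tested_columns A <= iota 0 (width m)} &
    (quarter m <= size (tested_columns A))%N].
  rewrite /tested_columns; case: ifP => qJ; split => //.
  - by rewrite filter_uniq// iota_uniq.
  - by move=> x; rewrite mem_filter => /andP[].
  - exact: iota_uniq.
  - by rewrite size_iota /width leq_pmull.
apply: (@explored_event_le _ _ _ p0_01 muP block_states
  (fun A => [seq column_states phi m x | x <- tested_columns A])); first exact: undup_uniq.
move=> A _ _; have [tu ts tq] := tested A; split.
- exact: uniq_columns.
- move=> e eB; apply/negP => /flatten_mapP[x _ /mem_column_states[j _ ee]].
  by have := block_states_neq_up (vtx m x j 0) eB; rewrite ee eqxx.
rewrite big_map (eq_bigr (fun=> 1 - p0 R ^+ m.+1)); last first.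
  by move=> x _; rewrite size_column_states.
rewrite big_const_seq count_predT iter_mulr_1.
apply: le_trans (bottleneck_fail_le R m).
by have /andP[? ?] := x01; exact: ler_wiXn2l.
Qed.

Lemma not_closed_crossing w : cut_open phi w m -> cut_open phi w m.+1 ->
  ~ closed_crossing w ->
  exists x, [/\ (x < width m)%N, in_giant phi w m x, in_giant phi w m.+1 x &
                all w (column_states phi m x)].
Proof.
move=> cm cm1; rewrite /closed_crossing /= /tested_columns good_columns_restrict.
rewrite (good_columns_size cm cm1) => /negP/allPn[_ /mapP[x xJ ->]].
move: xJ; rewrite mem_filter mem_iota /= add0n => /andP[/andP[g g1] xm] /negPn op.
by exists x.
Qed.

End crossings.

Lemma percolates_p0 : percolates H (p0 R).
Proof.
pose E m := closed_cut m `|` closed_crossing m.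
have mE m : measurable (E m).
  by apply: measurableU; [have [] := closed_cut_le m|have [] := closed_crossing_le m].
have null : mu (lim_sup_set E) = 0.
  apply: (measure_lim_sup_set0 (C := 1) (s := 2^-1)) => // [|m].
    by rewrite invr_ge0 ler0n/= invf_lt1//; lra.
  have [m1 l1] := closed_cut_le m; have [m2 l2] := closed_crossing_le m.
  apply: le_trans (measureU2 _ m1 m2) _; apply: le_trans (leeD l1 l2) _.
  by rewrite -EFinD lee_fin exprS; lra.
apply: (@negligibleS _ _ _ mu (lim_sup_set E)); last first.
  by exists (lim_sup_set E); split => //; exact: measurable_lim_sup_set.
move=> w /= nw; apply: contrapT => nlim; apply: nw.
have [m0 m0P] : exists m0, forall m, (m0 <= m)%N -> ~ E m w.
  apply: contrapT => hm; apply: nlim => m0 _; apply: contrapT => hE; apply: hm.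
  by exists m0 => m mm0 Em; apply: hE; exists m.
apply: (infinite_cluster_giants phi_inj phi_adj (m0 := m0)) => m mm0.
have cut n : (m0 <= n)%N -> cut_open phi w n.
  by move=> /m0P nE; apply: not_closed_cut => cn; apply: nE; left.
apply: not_closed_crossing; [exact: cut|exact/cut/leqW|].
by move=> cc; apply: (m0P m mm0); right.
Qed.

End percolation_at_p0.

(** * Mass transport *)
Section sums.
Variable R : realType.
Local Open Scope ereal_scope.

(** Sums over a countable type are series, for which scaling is available. *)
Lemma esum_pickle (T : countType) (a : T -> \bar R) : (forall i, 0 <= a i) ->
  \esum_(i in [set: T]) a i = \sum_(n <oo) oapp a 0 (pickle_inv n : option T).
Proof.
move=> a0; rewrite nneseries_esumT; last by move=> n; case: (pickle_inv n).
rewrite [RHS](_ : _ = \esum_(n in range (pickle : T -> nat)) oapp a 0 (pickle_inv n : option T)).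
  rewrite esum_image; last by move=> x y _ _; exact: (pcan_inj pickleK).
  by apply: eq_esum => i _; rewrite pickleK_inv.
rewrite [RHS]esum_mkcond; apply: eq_esum => n _; case: ifPn => // /negP nr.
case: (pickle_inv n : option T) (pickle_invK (T := T) n) => //= x xn.
by exfalso; apply: nr; rewrite inE; exists x.
Qed.

Lemma esumZl (T : countType) (a : T -> \bar R) (c : R) : (0 <= c)%R ->
  (forall i, 0 <= a i) ->
  \esum_(i in [set: T]) (c%:E * a i) = c%:E * \esum_(i in [set: T]) a i.
Proof.
move=> c0 a0; rewrite !esum_pickle//; last by move=> i; rewrite mule_ge0.
rewrite -nneseriesZl//; last by move=> n _; case: (pickle_inv n).
by apply: eq_eseriesr => n _; case: (pickle_inv n) => //=; rewrite mule0.
Qed.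

Lemma esum_pair (S T : choiceType) (a : S * T -> \bar R) : (forall i, 0 <= a i) ->
  \esum_(x in [set: S * T]) a x = \esum_(i in [set: S]) \esum_(j in [set: T]) a (i, j).
Proof.
move=> a0; rewrite esum_esum; last by move=> i j _ _; exact: a0.
rewrite (_ : _ `*`` _ = [set: S * T]); last by apply/seteqP; split.
by apply: eq_esum => -[].
Qed.

Lemma esum_exchange (S T : choiceType) (a : S -> T -> \bar R) : (forall i j, 0 <= a i j) ->
  \esum_(i in [set: S]) \esum_(j in [set: T]) a i j =
  \esum_(j in [set: T]) \esum_(i in [set: S]) a i j.
Proof.
move=> a0.
rewrite -(@esum_pair _ _ (fun x => a x.1 x.2)) // -(@esum_pair _ _ (fun x => a x.2 x.1)) //.
rewrite (reindex_esum setT setT (fun x : T * S => (x.2, x.1)))//.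
by rewrite setTT_bijective; exists (fun x : S * T => (x.2, x.1)); case.
Qed.

Lemma esum_divn (N : nat) (h : nat -> \bar R) : (0 < N)%N -> (forall a, 0 <= h a) ->
  \esum_(g in [set: nat]) h (g %/ N)%N = N%:R%:E * \esum_(a in [set: nat]) h a.
Proof.
move=> N0 h0.
have bij : set_bij [set: nat * 'I_N] [set: nat] (fun q : nat * 'I_N => (q.1 * N + q.2)%N).
  rewrite setTT_bijective; exists (fun g => (g %/ N, Ordinal (ltn_pmod g N0))%N).
    move=> [a r] /=; rewrite divnMDl// divn_small// addn0; congr (_, _).
    by apply: val_inj; rewrite /= modnMDl modn_small.
  by move=> g /=; rewrite -divn_eq.
rewrite (reindex_esum _ _ _ _ bij) esum_pair//.
rewrite -esumZl// ?ler0n//; apply: eq_esum => a _ /=.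
rewrite esum_fset//; last exact: finite_finset.
rewrite (eq_fsbigr (fun=> h a)); last first.
  by move=> r _; rewrite divnMDl// divn_small// addn0.
rewrite (_ : [set: 'I_N] = [set` enum 'I_N]); last first.
  by apply/seteqP; split=> // r _ /=; rewrite mem_enum.
rewrite -fsbig_seq ?enum_uniq// big_const_seq count_predT size_enum_ord iter_addr_0.
by rewrite mule_natl.
Qed.

Variable F : vertex -> vertex -> \bar R.
Hypothesis F_ge0 : forall u v, 0 <= F u v.
Hypothesis F_translate : forall g u v, F (translate g u) (translate g v) = F u v.

Definition cell_level (b : cell) : nat := (val b).1.1.

(** Block 0 of level n is fixed by the 8^n translations with at most 3 n bits. *)
Definition cell_weight (b : cell) : R := (8%:R^-1 ^+ cell_level b)%R.

Lemma cell_weight_ge0 b : (0 <= cell_weight b)%R.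
Proof. by rewrite exprn_ge0// invr_ge0 ler0n. Qed.

(** The sum over an orbit is the sum over the group, divided by the order of the
    stabilizers. *)
Lemma esum_vertex (h : vertex -> \bar R) : (forall v, 0 <= h v) ->
  \esum_(v in [set: vertex]) h v =
  \esum_(b in [set: cell]) \esum_(g in [set: nat])
     ((cell_weight b)%:E * h (b, Nat.shiftr g (3 * cell_level b))).
Proof.
move=> h0; rewrite esum_pair//; apply: eq_esum => b _.
rewrite esumZl ?cell_weight_ge0//.
under [X in _ = _ * X]eq_esum do rewrite shiftr_divn expnM.
rewrite (@esum_divn _ (fun a => h (b, a))) ?expn_gt0// muleA -EFinM.
rewrite /cell_weight natrX -exprMn mulVf ?pnatr_eq0// expr1n mul1e//.
Qed.

(** Both sides are sums over two cells b, b' and a translation g; translating by g, which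
    is its own inverse, moves g from one argument of F to the other. *)
Lemma mass_transport_sum :
  \esum_(b in [set: cell]) ((cell_weight b)%:E * \esum_(v in [set: vertex]) F (b, 0%N) v) =
  \esum_(b in [set: cell]) ((cell_weight b)%:E * \esum_(v in [set: vertex]) F v (b, 0%N)).
Proof.
pose S b b' := \esum_(g in [set: nat])
  ((cell_weight b)%:E * ((cell_weight b')%:E * F (b, 0%N) (b', Nat.shiftr g (3 * cell_level b')))).
have w0 := cell_weight_ge0.
have S0 b b' : 0 <= S b b'.
  by apply: esum_ge0 => g _; rewrite !mule_ge0// lee_fin.
transitivity (\esum_(b in [set: cell]) \esum_(b' in [set: cell]) S b b').
  apply: eq_esum => b _; rewrite esum_vertex// -esumZl//; last first.
    by move=> b'; apply: esum_ge0 => g _; rewrite mule_ge0// lee_fin.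
  apply: eq_esum => b' _; rewrite -esumZl// => g; by rewrite mule_ge0// lee_fin.
rewrite esum_exchange//; apply: eq_esum => b _.
rewrite esum_vertex// -esumZl//; last first.
  by move=> b'; apply: esum_ge0 => g _; rewrite mule_ge0// lee_fin.
apply: eq_esum => b' _; rewrite -esumZl//; last first.
  by move=> g; rewrite mule_ge0// lee_fin.
apply: eq_esum => g _; rewrite muleCA; congr (_ * (_ * _)).
rewrite -(F_translate g); congr F.
- by rewrite /translate PeanoNat.Nat.lxor_0_l.
- by rewrite /translate PeanoNat.Nat.lxor_nilpotent.
Qed.

End sums.

(** * The law of the root *)
Section discrete_law.
Variable R : realType.
Local Open Scope ereal_scope.

Lemma mnormalizeE d (T : measurableType d) (mu : {measure set T -> \bar R})
    (P : probability T R) (A : set T) : 0 < mu setT < +oo ->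
  mnormalize mu P A = mu A * ((fine (mu setT))^-1)%:E.
Proof.
move=> /andP[gt0 ltoo]; rewrite /mnormalize /=.
by rewrite (gt_eqF gt0) (lt_eqF ltoo).
Qed.

Lemma exists_weighted_law (w : nat -> R) : (forall n, (0 <= w n)%R) ->
  0 < \sum_(n <oo) (w n)%:E < +oo ->
  exists (P : probability nat R) (c : R), (0 <= c)%R /\
    forall f : nat -> \bar R, (forall n, 0 <= f n) ->
      \int[P]_t f t = c%:E * \sum_(n <oo) ((w n)%:E * f n).
Proof.
move=> w0 /andP[wgt0 wlty].
pose dw n : {measure set nat -> \bar R} := mscale (NngNum (w0 n)) (dirac n).
pose mu : {measure set nat -> \bar R} := mseries dw 0.
have muT : mu setT = \sum_(n <oo) (w n)%:E.
  rewrite /mu /= /mseries; apply: eq_eseriesr => n _.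
  by rewrite /dw /= /mscale /= diracT mule1.
have c0 : (0 <= (fine (mu setT))^-1)%R by rewrite invr_ge0 fine_ge0// muT ltW.
exists (mnormalize mu (dirac 0%N : probability nat R)), ((fine (mu setT))^-1)%R; split => // f f0.
have mf : @measurable_fun _ _ nat (\bar R) setT f by [].
have -> : \int[mnormalize mu (dirac 0%N : probability nat R)]_t f t =
    \int[mscale (NngNum c0) mu]_t f t.
  apply: eq_measure_integral => A mA _; transitivity (mu A * ((fine (mu setT))^-1)%:E).
    by apply: mnormalizeE; rewrite muT wgt0.
  by rewrite /mscale /= muleC.
rewrite ge0_integral_mscale//; congr (_ * _).
rewrite /mu ge0_integral_measure_series//; apply: eq_eseriesr => n _.
by rewrite /dw ge0_integral_mscale// integral_dirac// diracT mul1e.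
Qed.

Lemma esum_below (N : nat) (c : \bar R) : 0 <= c ->
  \esum_(j in [set: nat]) (if (j < N)%N then c else 0) = N%:R%:E * c.
Proof.
move=> c0; rewrite (eq_esum (b := fun j => if j \in `I_N then c else 0)); last first.
  by move=> j _; rewrite mem_setE.
rewrite -esum_mkcond esum_fset; [|exact: finite_II|by []].
rewrite -(fsbig_ord _ _ (fun=> c)) big_const_seq count_predT iter_addr_0.
by rewrite mule_natl /index_enum -enumT size_enum_ord.
Qed.

(** The cells of level n contribute width n (n + 1) 8^-n, which is at most
    8 2^n 2^n 8^-n = 8 2^-n. *)
Lemma total_weight_fin : 0 < \esum_(b in [set: cell]) (cell_weight R b)%:E < +oo.
Proof.
have w0 b : 0 <= (cell_weight R b)%:E by rewrite lee_fin cell_weight_ge0.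
apply/andP; split.
  apply: (@lt_le_trans _ _ 1%:E) => //; apply: esum_ge.
  exists [set (Sub _ valid_cell0 : cell)]; first by split.
  by rewrite fsbig_set1 /cell_weight /cell_level /= expr0.
have -> : \esum_(b in [set: cell]) (cell_weight R b)%:E =
    \esum_(q in range (val : cell -> nat * nat * nat)) (8%:R^-1 ^+ q.1.1)%:E.
  by rewrite esum_image// => x y _ _; exact: val_inj.
rewrite esum_mkcond (eq_esum (b := fun q : nat * nat * nat => if (q.2 < q.1.1.+1)%N then
  (if (q.1.2 < width q.1.1)%N then (8%:R^-1 ^+ q.1.1 : R)%:E else 0) else 0)); last first.
  move=> -[[n x] j] _ /=.
  case: ifPn => [|nq].
    rewrite inE => -[[q' h'] _ /= qE]; move: h'; rewrite qE /valid_cell /=.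
    by move=> /andP[-> jn]; rewrite ltnS jn.
  case: ifP => // jn; case: ifP => // xn; exfalso; move/negP: nq; apply; rewrite inE.
  by exists (Sub (n, x, j) (introT andP (conj xn jn))).
have e0 n : 0 <= (8%:R^-1 ^+ n : R)%:E by rewrite lee_fin exprn_ge0// invr_ge0 ler0n.
rewrite esum_pair; last by move=> q; case: ifP => // _; case: ifP.
rewrite (eq_esum (b := fun q => if (q.2 < width q.1)%N
  then q.1.+1%:R%:E * (8%:R^-1 ^+ q.1)%:E else 0)); last first.
  move=> [n x] _ /=; apply: etrans (esum_below n.+1 (c := if (x < width n)%N then _ else _) _) _.
    by case: ifP.
  by case: ifP => //; rewrite mule0.
rewrite esum_pair; last by move=> q; case: ifP => // _; rewrite mule_ge0.
rewrite (eq_esum (b := fun n => (width n)%:R%:E * (n.+1%:R%:E * (8%:R^-1 ^+ n)%:E))); last first.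
  by move=> n _ /=; apply: (@esum_below (width n)); rewrite mule_ge0.
rewrite -nneseries_esumT; last by move=> n; rewrite !mule_ge0.
apply: (@le_lt_trans _ _ (16%:E)); last exact: ltry.
apply: lime_le; first by apply: is_cvg_nneseries => n _ _; rewrite !mule_ge0.
apply: nearW => N.
apply: (@le_trans _ _ (\sum_(0 <= n < N) (8 * 2^-1 ^+ n)%:E)).
  apply: lee_sum => n _; rewrite -!EFinM lee_fin.
  have <- : (8 * 2 ^+ n * (2 ^+ n * 8%:R^-1 ^+ n) = 8 * 2^-1 ^+ n :> R)%R.
    by rewrite -mulrA -!exprMn; congr (_ * _ ^+ n)%R; lra.
  apply: ler_pM; rewrite ?ler0n// ?mulr_ge0 ?ler0n ?exprn_ge0 ?invr_ge0 ?ler0n//.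
    by rewrite -natrX -natrM ler_nat leq_width_exp.
  by rewrite ler_wpM2r ?exprn_ge0 ?invr_ge0 ?ler0n// -natrX ler_nat ltn_expl.
rewrite sumEFin lee_fin -mulr_sumr.
have geo : (\sum_(0 <= i < N) 2^-1 ^+ i = 2 - 2 * 2^-1 ^+ N :> R)%R.
  elim: N => [|N IH]; first by rewrite big_geq// expr0; lra.
  by rewrite big_nat_recr//= IH exprS; lra.
have : (0 <= 2^-1 ^+ N :> R)%R by rewrite exprn_ge0// invr_ge0.
by rewrite geo; lra.
Qed.

End discrete_law.

(** * The canopy as a graph on natural numbers *)
Definition code_set : set nat := range (pickle : vertex -> nat).

Definition code (u : vertex) : code_set := SigSub (mem_set (ex_intro2 _ _ u I erefl)).

Definition decode (y : code_set) : vertex := s2val (cid2 (set_valP y)).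

Lemma pickle_decode y : pickle (decode y) = val y.
Proof. by rewrite /decode; case: cid2. Qed.

Lemma decodeK : cancel decode code.
Proof. by move=> y; apply: val_inj; rewrite -[RHS]pickle_decode. Qed.

Lemma codeK : cancel code decode.
Proof.
by move=> u; apply: (pcan_inj (@pickleK vertex)); rewrite pickle_decode.
Qed.

Definition canopy_adj : rel code_set := fun y z => edge (decode y) (decode z).

Lemma canopy_adj_sym : symmetric canopy_adj.
Proof. by move=> y z; rewrite /canopy_adj edge_sym. Qed.

Lemma canopy_adj_irr : irreflexive canopy_adj.
Proof. by move=> y; rewrite /canopy_adj edge_irr. Qed.

Definition canopy : graph := Graph canopy_adj_sym canopy_adj_irr.

Lemma canopy_adj_code u v : adj canopy (code u) (code v) = edge u v.
Proof. by rewrite /= /canopy_adj !codeK. Qed.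

Lemma canopy_connected : connected_graph canopy.
Proof.
move=> y z; have [p [yp pz]] := joined_all (decode y) (decode z).
exists (map code p); split; last by rewrite -(decodeK y) last_map pz decodeK.
rewrite -(decodeK y) path_map (eq_path (e' := edge))//.
exact: canopy_adj_code.
Qed.

(** Stated for any copy of the canopy, as the representatives of its classes need it. *)
Section degrees.
Variables (H : graph) (phi : vertex -> vert H).
Hypothesis phi_inj : injective phi.
Hypothesis phi_surj : forall y, exists u, phi u = y.
Hypothesis phi_adj : forall u v, adj H (phi u) (phi v) = edge u v.

Lemma degree_le_embedding : degree_le H 52.
Proof.
move=> y; have [u <-] := phi_surj y; have [s sz sP] := edge_degree u.
pose raw v := (level v, column v, height v, block v).
have raw_inj : injective raw by move=> v w [? ? ? ?]; exact: vertex_eq.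
have -> : neighbors (phi u) = phi @` [set v | edge u v].
  apply/seteqP; split => [z|_ [v uv <-]]; rewrite /neighbors /= ?phi_adj//.
  by have [v <-] := phi_surj z; rewrite phi_adj => uv; exists v.
apply: (card_le_trans (card_image_le _ _)).
have rI : {in [set v | edge u v] &, injective (fun v => index (raw v) s)}.
  move=> v w /set_mem uv /set_mem uw /(congr1 (nth (raw u) s)).
  by rewrite /= !nth_index ?sP//; exact: raw_inj.
rewrite -(card_le_eql (inj_card_eq rI)); apply: subset_card_le.
by move=> _ [v uv <-] /=; apply: leq_trans sz; rewrite index_mem sP.
Qed.

End degrees.

Lemma code_inj : injective code. Proof. exact: can_inj codeK. Qed.
Lemma code_surj y : exists u, code u = y. Proof. by exists (decode y); exact: decodeK. Qed.

Lemma canopy_locally_finite : locally_finite canopy.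
Proof.
move=> y; have := @degree_le_embedding canopy code code_surj canopy_adj_code y.
by move=> /card_le_finite; apply; exact: finite_II.
Qed.

Definition marked_canopy k (t : k.+1.-tuple vertex) : marked_graph k :=
  MarkedGraph canopy_connected canopy_locally_finite (map_tuple code t).

Lemma marked_isoI k (G H : marked_graph k) (phi : vertex -> vert G) (psi : vertex -> vert H) :
  injective phi -> (forall y, exists u, phi u = y) ->
  (forall u v, adj G (phi u) (phi v) = edge u v) ->
  injective psi -> (forall y, exists u, psi u = y) ->
  (forall u v, adj H (psi u) (psi v) = edge u v) ->
  (forall i, exists2 u, phi u = tnth (marks G) i & psi u = tnth (marks H) i) ->
  marked_iso G H.
Proof.
move=> phiI phiS phiA psiI psiS psiA mk.
have [inv invK] := choice phiS.
have phiK : cancel phi inv by move=> u; apply: phiI; rewrite invK.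
exists (psi \o inv); split=> [|y z _ _|i] /=.
- rewrite setTT_bijective; have [inv' invK'] := choice psiS.
  exists (phi \o inv') => [y|z] /=; last by rewrite phiK invK'.
  by rewrite -[RHS]invK; congr phi; apply: psiI; rewrite invK'.
- by rewrite psiA -phiA !invK.
- by have [u <- <-] := mk i; rewrite phiK.
Qed.

Definition canopy_class k (t : k.+1.-tuple vertex) : marked_space k :=
  \pi_(marked_class k) (marked_canopy t).

Lemma marked_iso_class k (G H : marked_graph k) : marked_iso G H ->
  \pi_(marked_class k) G = \pi_(marked_class k) H.
Proof. by move=> GH; apply/eqmodP/asboolP. Qed.

(** * The rooted canopy *)
Lemma representative_embedding k (t : k.+1.-tuple vertex)
    (H := representative (canopy_class t)) :
  exists phi : vertex -> vert H, [/\ injective phi, forall y, exists u, phi u = y,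
    forall u v, adj H (phi u) (phi v) = edge u v
    & forall i, phi (tnth t i) = tnth (marks H) i].
Proof.
have [phi [phiB phiA phiM]] : marked_iso (marked_canopy t) H.
  have /eqmodP/asboolP : \pi_(marked_class k) (marked_canopy t) = \pi_(marked_class k) H.
    by rewrite /H /representative reprK.
  exact.
exists (phi \o code); split=> [u v /= e|y|u v|i] /=.
- apply: code_inj; move: phiB; rewrite setTT_bijective => /bij_inj; exact.
- move: phiB; rewrite setTT_bijective => -[inv _ invK]; exists (decode (inv y)).
  by rewrite decodeK invK.
- by rewrite phiA// canopy_adj_code.
- by rewrite -phiM tnth_map.
Qed.

Lemma birooted_class_embedding (H : marked_graph 0) (phi : vertex -> vert H) u v :
  injective phi -> (forall y, exists u, phi u = y) ->
  (forall u v, adj H (phi u) (phi v) = edge u v) ->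
  birooted_class (phi u) (phi v) = canopy_class [tuple u; v].
Proof.
move=> phiI phiS phiA; apply: marked_iso_class.
apply: (@marked_isoI 1 (MarkedGraph (@mgraph_connected _ H)
  (@mgraph_locally_finite _ H) [tuple phi u; phi v]) (marked_canopy [tuple u; v]) phi code) => //.
- exact: code_inj.
- exact: code_surj.
- exact: canopy_adj_code.
- move=> i; exists (tnth [tuple u; v] i); last by rewrite tnth_map.
  by case: i => -[|[|]].
Qed.

Lemma canopy_class_translate g u v :
  canopy_class [tuple translate g u; translate g v] = canopy_class [tuple u; v].
Proof.
have tK := translateK g; apply: marked_iso_class.
apply: (@marked_isoI 1 (marked_canopy [tuple translate g u; translate g v])
  (marked_canopy [tuple u; v]) (code \o translate g) code).
- exact: inj_comp code_inj (inv_inj tK).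
- by move=> y; exists (translate g (decode y)); rewrite /= tK decodeK.
- by move=> a b; rewrite canopy_adj_code translate_edge.
- exact: code_inj.
- exact: code_surj.
- exact: canopy_adj_code.
- move=> i; exists (tnth [tuple u; v] i); rewrite tnth_map//.
  by case: i => -[|[|]].
Qed.

(** The sample space is nat: its elements code the cells, and the root is taken in block
    0. Numbers that code no cell have weight 0. *)
Definition root_vertex (t : nat) : vertex :=
  (odflt (Sub _ valid_cell0) (pickle_inv t : option cell), 0%N).

Definition rooted_canopy (t : nat) : rooted_space := canopy_class [tuple root_vertex t].

Lemma measurable_rooted_canopy : measurable_fun [set: nat] rooted_canopy.
Proof. by []. Qed.

HB.instance Definition _ := isMeasurableFun.Build _ _ _ _ rooted_canopy measurable_rooted_canopy.

Section rooted_canopy_law.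
Variable R : realType.

Definition root_weight (t : nat) : R :=
  if pickle_inv t is Some b then cell_weight R b else 0.

Lemma root_weight_ge0 t : 0 <= root_weight t.
Proof. by rewrite /root_weight; case: pickle_inv => // b; exact: cell_weight_ge0. Qed.

Lemma root_weight_sum (h : cell -> \bar R) : (forall b, 0 <= h b)%E ->
  (\sum_(t <oo) ((root_weight t)%:E * h (root_vertex t).1) =
   \esum_(b in [set: cell]) ((cell_weight R b)%:E * h b))%E.
Proof.
move=> h0; rewrite esum_pickle; last by move=> b; rewrite mule_ge0// lee_fin cell_weight_ge0.
apply: eq_eseriesr => t _; rewrite /root_weight /root_vertex.
by case: (pickle_inv t) => //=; rewrite mul0e.
Qed.

Lemma unimodular_rooted_canopy (P : probability nat R) (c : R) : 0 <= c ->
  (forall f : nat -> \bar R, (forall n, 0 <= f n)%E ->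
     \int[P]_t f t = c%:E * \sum_(n <oo) ((root_weight n)%:E * f n))%E ->
  unimodular (P := P) rooted_canopy.
Proof.
move=> c0 PE f mf f0.
pose F u v := f (canopy_class [tuple u; v]).
have FE t : ((let G := representative (rooted_canopy t) in
     \esum_(v in [set: vert G]) f (birooted_class (Defs.root G) v)) =
     \esum_(v in [set: vertex]) F (root_vertex t) v)%E /\
  ((let G := representative (rooted_canopy t) in
     \esum_(v in [set: vert G]) f (birooted_class v (Defs.root G))) =
     \esum_(v in [set: vertex]) F v (root_vertex t))%E.
  have [phi [phiI phiS phiA phiM]] := representative_embedding [tuple root_vertex t].
  have phi_bij : set_bij [set: vertex] setT phi.
    by split=> // [u v _ _ /phiI//|y _]; have [u <-] := phiS y; exists u.
  have rootE : Defs.root (representative (rooted_canopy t)) = phi (root_vertex t).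
    by rewrite /Defs.root /thead -phiM.
  split=> /=; rewrite rootE (reindex_esum _ _ _ _ phi_bij);
  by apply: eq_esum => v _; rewrite birooted_class_embedding.
under eq_integral do rewrite (FE _).1.
under [RHS]eq_integral do rewrite (FE _).2.
have F0 u v : (0 <= F u v)%E by exact: f0.
rewrite !PE; try by move=> n; exact: esum_ge0.
congr (_ * _)%E.
rewrite (root_weight_sum (h := fun b => \esum_(v in setT) F (b, 0%N) v)%E); last first.
  by move=> b; exact: esum_ge0.
rewrite (root_weight_sum (h := fun b => \esum_(v in setT) F v (b, 0%N))%E); last first.
  by move=> b; exact: esum_ge0.
apply: mass_transport_sum => // g u v.
by rewrite /F canopy_class_translate.
Qed.

Lemma critical_probability_embedding (H : graph) (phi : vertex -> vert H) :
  injective phi -> (forall y, exists u, phi u = y) ->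
  (forall u v, adj H (phi u) (phi v) = edge u v) -> critical_probability R H = p0 R.
Proof.
move=> phiI phiS phiA; have /andP[p00 p01] := p0_itv R.
have p0S : [set p | 0 <= p <= 1 /\ percolates H p] (p0 R).
  by split; [rewrite !ltW|exact: percolates_p0 phiI phiA].
have lb : lbound [set p | 0 <= p <= 1 /\ percolates H p] (p0 R).
  move=> p [/andP[p_ge0 _] perc]; rewrite leNgt; apply/negP => pp0.
  by apply: (not_percolates_lt_p0 phiI phiS phiA (p := p)) perc; rewrite p_ge0.
apply/eqP; rewrite eq_le; apply/andP; split.
- by apply: ge_inf p0S; exists (p0 R).
- by apply: lb_le_inf => //; exists (p0 R).
Qed.

End rooted_canopy_law.

Theorem theorem1p3 (R : realType) :
  exists (d : measure_display) (T : measurableType d) (P : probability T R)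
         (X : {RV P >-> rooted_space}),
    [/\ unimodular X,
        bounded_degree X &
        {ae P, forall t,
          let G := representative (X t) in
          let pc := critical_probability R G in
          pc < 1 /\ percolates G pc}].
Proof.
have [|P [c [c0 PE]]] := exists_weighted_law (root_weight_ge0 R).
  have := root_weight_sum (R := R) (h := fun=> 1%E) (fun=> lee01).
  under eq_eseriesr do rewrite mule1.
  move=> ->; under eq_esum do rewrite mule1; exact: total_weight_fin.
exists default_measure_display, nat, P, rooted_canopy; split.
- exact: unimodular_rooted_canopy c0 PE.
- exists 52%N; apply: aeW => t.
  have [phi [phiI phiS phiA _]] := representative_embedding [tuple root_vertex t].
  exact: degree_le_embedding phiS phiA.
- apply: aeW => t /=.
  have [phi [phiI phiS phiA _]] := representative_embedding [tuple root_vertex t].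
  rewrite (critical_probability_embedding R phiI phiS phiA); split.
    by have /andP[] := p0_itv R.
  exact: percolates_p0 phiI phiA.
Qed.
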